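(* Let $\Psi$ be an affine flow on $B\times H$ with linear part $\Phi$ and lift $\Psi^1$ to $B\times H^1$, $H^1=H\times\mathbb{R}$. (i) For $(b,x)\in B\times H$ the equality $\Psi^1_t(b,x,0)=(\Phi_t(b,x),0)$, $t\in\mathbb{R}$, holds, and the map $$h^0:B\times\mathbb{P}H\to B\times\mathbb{P}H^{1,0},\quad h^0(b,\mathbb{P}x)=(b,\mathbb{P}(x,0)),$$ is a conjugacy of the flow $\mathbb{P}\Phi$ and the flow $\mathbb{P}\Psi^1$ restricted to $B\times\mathbb{P}H^{1,0}$. In particular, the chain recurrent components $\mathcal{M}_i=\mathbb{P}\mathcal{V}_i$, $i\in\{1,\dots,\ell\}$, of $\mathbb{P}\Phi$ yield the chain recurrent components $h^0(\mathcal{M}_i)=\mathbb{P}(\mathcal{V}_i\times\{0\})$, $i\in\{1,\dots,\ell\}$, of $\mathbb{P}\Psi^1$ restricted to $B\times\mathbb{P}H^{1,0}$, and their order is preserved. (ii) The map $$h^1:B\times H\to B\times\mathbb{P}H^{1,1},\quad h^1(b,x)=(b,\mathbb{P}(x,1)),$$ is a conjugacy of the flow $\Psi$ on $B\times H$ and the flow $\mathbb{P}\Psi^1$ restricted to $B\times\mathbb{P}H^{1,1}$. (iii) For $\varepsilon,T>0$ any $(\varepsilon,T)$-chain (for $\Psi$) in $B\times H$ is mapped by $h^1$ onto a $(2\varepsilon,T)$-chain (for $\mathbb{P}\Psi^1$) in $B\times\mathbb{P}H^{1,1}$; hence any chain transitive set $C\subset B\times H$ is mapped onto a chain transitive set $h^1(C)\subset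 B\times\mathbb{P}H^{1,1}$. (iv) For a subset $C\subset B\times H$ the set $\{x\in H\mid (b,x)\in C\text{ for some }b\in B\}$ is bounded if and only if $\overline{h^1(C)}\cap(B\times\mathbb{P}H^{1,0})=\varnothing$, where the closure is taken in $B\times\mathbb{P}H^1$.
   Context: Flows and chains: A flow on a metric space $X$ is a continuous map $\Phi:\mathbb{R}\times X\to X$ with $\Phi_0=\mathrm{id}$, $\Phi_{t+s}=\Phi_t\circ\Phi_s$. A conjugacy of flows $\Phi'$ on $X'$ and $\Phi''$ on $X''$ is a homeomorphism $h:X'\to X''$ with $h(\Phi'_t(x))=\Phi''_t(h(x))$ for all $t,x$. For $\varepsilon,T>0$ an $(\varepsilon,T)$-chain from $x$ to $y$ consists of $n\in\mathbb{N}$ ($n\ge1$), $T_0,\dots,T_{n-1}\ge T$ and $x_0=x,x_1,\dots,x_n=y\in X$ with $d(\Phi_{T_i}(x_i),x_{i+1})<\varepsilon$ for $i=0,\dots,n-1$. $\Omega(x)$ is the set of $y$ such that for all $\varepsilon,T>0$ there is an $(\varepsilon,T)$-chain from $x$ to $y$. A set $Y$ is chain transitive if $y\in\Omega(x)$ for all $x,y\in Y$. A chain recurrent component is a maximal chain transitive set. Order: $\mathcal{M}\preceq\mathcal{M}'$ for chain recurrent components if there are components $\mathcal{M}=\mathcal{N}_0,\dots,\mathcal{N}_n=\mathcal{M}'$ and points $x_1,\dots,x_n$ with $\alpha$-limit set $\alpha(x_k)\subset\mathcal{N}_{k-1}$ and $\omega$-limit set $\omega(x_k)\subset\mathcal{N}_k$.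 Linear flows: $B$ is a compact metric space with a chain transitive flow $\theta$ and $H$ is a real Hilbert space of finite dimension $d$. A linear flow on $B\times H$ is a flow $\Phi_t(b,x)=(\theta_tb,\varphi(t,b,x))$ with $\varphi(t,b,\cdot)$ linear. $\mathbb{P}H$ is the projective space of $H$; $\mathbb{P}$ denotes the projections $H\setminus\{0\}\to\mathbb{P}H$ and $B\times(H\setminus\{0\})\to B\times\mathbb{P}H$ (for a set $\mathcal V\subset B\times H$, $\mathbb{P}\mathcal V$ is the image of its points with nonzero $H$-component). $\mathbb{P}H$ has the metric $d(\mathbb{P}x,\mathbb{P}y)=\min\{\|\frac{x}{\|x\|}-\frac{y}{\|y\|}\|,\|\frac{x}{\|x\|}+\frac{y}{\|y\|}\|\}$, and products with $B$ have the maximum metric (also $B\times H$). $\Phi$ induces a flow $\mathbb{P}\Phi$ on $B\times\mathbb{P}H$. By Selgrade's theorem, $\mathbb{P}\Phi$ has finitely many chain recurrent components $\mathcal{M}_1\preceq\dots\preceq\mathcal{M}_\ell$, $1\le\ell\le d$; the sets $\mathcal{V}_i=\{(b,x)\in B\times H\mid x\ne0\Rightarrow(b,\mathbb{P}x)\in\mathcal{M}_i\}$ are subbundles (the Selgrade bundles) and $B\times H=\mathcal{V}_1\oplus\dots\oplus\mathcal{V}_\ell$. Affine flows: An affine flow on $B\times H$ is a continuous map $\Psi=(\theta,\psi)$ for which there are a linear flow $\Phi=(\theta,\varphi)$ (the linear part) and $f:B\to L^\infty(\mathbb{R},H)$ with $f(b)(t+s)=f(\theta_sb)(t)$ for all $b$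 and almost all $t,s$, and $\psi(t,b,x)=\varphi(t,b,x)+\int_0^t\varphi(t-s,\theta_sb,f(b)(s))\,ds$. Its lift is the linear flow on $B\times H^1$, $H^1=H\times\mathbb{R}$ (with the product Hilbert norm), given by $\Psi^1_t(b,x,r)=(\theta_tb,\varphi(t,b,x)+r\int_0^t\varphi(t-s,\theta_sb,f(b)(s))\,ds,r)$. Further, $\mathbb{P}H^{1,0}=\{\mathbb{P}(x,0)\mid 0\neq x\in H\}$ and $\mathbb{P}H^{1,1}=\{\mathbb{P}(x,r)\mid x\in H,r\ne0\}$; both $B\times\mathbb{P}H^{1,0}$ and $B\times\mathbb{P}H^{1,1}$ are invariant under $\mathbb{P}\Psi^1$. *)

(* Defs.v *)
From HB Require Import structures.
From mathcomp Require Import all_boot all_order all_algebra.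
From mathcomp Require Import all_classical all_reals all_analysis.
From mathcomp Require Import generic_quotient lra.

Set Implicit Arguments.
Unset Strict Implicit.
Unset Printing Implicit Defensive.

Import Order.TTheory GRing.Theory Num.Theory.
Import numFieldNormedType.Exports.

Local Open Scope classical_set_scope.
Local Open Scope ring_scope.
Local Open Scope quotient_scope.

(* [ball x e y] reads d(x, y) < e.  The library's balls are those of the maximum
   metric on a product, of the norm metric on a normed module, and of the
   restricted metric on the type of points of a set. *)

Section Flows.
Context {R : realType} {X : pseudoMetricType R}.
Implicit Types (Phi : R -> X -> X) (x y : X) (Y : set X).

Definition is_flow Phi :=
  [/\ continuous (fun p : R * X => Phi p.1 p.2),
      forall x, Phi 0 x = x &
      forall t s x, Phi (t + s) x = Phi t (Phi s x)].

Definition is_chain Phi (e T : R) (n : nat) (tau : nat -> R) (xi : nat -> X) :=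
  [/\ (0 < n)%N,
      forall i, (i < n)%N -> T <= tau i &
      forall i, (i < n)%N -> ball (Phi (tau i) (xi i)) e (xi i.+1)].

Definition chain_limit Phi x : set X := [set y |
  forall e T : R, 0 < e -> 0 < T ->
  exists n tau xi, [/\ is_chain Phi e T n tau xi, xi 0%N = x & xi n = y]].

Definition chain_transitive Phi Y :=
  forall x y, Y x -> Y y -> chain_limit Phi x y.

Definition chain_component Phi Y :=
  chain_transitive Phi Y /\
  forall Z, chain_transitive Phi Z -> Y `<=` Z -> Z = Y.

Definition omega_limit Phi x : set X := [set y |
  exists t : nat -> R, t @ \oo --> +oo /\ (Phi (t k) x @[k --> \oo] --> y)].

Definition alpha_limit Phi x : set X := [set y |
  exists t : nat -> R, t @ \oo --> -oo /\ (Phi (t k) x @[k --> \oo] --> y)].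

Definition chain_order Phi (M M' : set X) :=
  exists n (N : nat -> set X) (x : nat -> X),
  [/\ N 0%N = M, N n = M',
      forall k, (k <= n)%N -> chain_component Phi (N k) &
      forall k, (k < n)%N ->
        alpha_limit Phi (x k.+1) `<=` N k /\
        omega_limit Phi (x k.+1) `<=` N k.+1].

(* M 0, ..., M (l - 1) lists every chain recurrent component exactly once, in an
   order compatible with [chain_order]. *)
Definition ordered_components Phi (l : nat) (M : 'I_l -> set X) :=
  [/\ injective M,
      forall N, chain_component Phi N <-> exists i, M i = N &
      forall i j : 'I_l, (i <= j)%N -> chain_order Phi (M i) (M j)].

Definition restrict_flow Phi Y (invY : forall t x, Y x -> Y (Phi t x))
    (t : R) (y : Y) : Y :=
  SigSub (mem_set (invY t (\val y) (set_mem (valP y)))).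

End Flows.

Definition homeomorphism (T1 T2 : topologicalType) (h : T1 -> T2) :=
  continuous h /\
  exists g : T2 -> T1, [/\ continuous g, cancel h g & cancel g h].

Definition conjugacy (R : realType) (X1 X2 : pseudoMetricType R)
    (Phi1 : R -> X1 -> X1) (Phi2 : R -> X2 -> X2) (h : X1 -> X2) :=
  [/\ is_flow Phi1, is_flow Phi2, homeomorphism h &
      forall t x, h (Phi1 t x) = Phi2 t (h x)].

(* The dimension is [dim H] of vector.v; completeness is automatic. *)

HB.mixin Record NormedModule_isHilbert (R : realType) H & NormedModule R H := {
  hdot : H -> H -> R ;
  hdotC : forall x y, hdot x y = hdot y x ;
  hdotDl : forall x y z, hdot (x + y) z = hdot x z + hdot y z ;
  hdotZl : forall (a : R) x y, hdot (a *: x) y = a * hdot x y ;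
  hdotxx : forall x, hdot x x = `|x| ^+ 2
}.

#[short(type="finHilbertType")]
HB.structure Definition FinHilbert (R : realType) :=
  { H of NormedModule R H & Vector R H & NormedModule_isHilbert R H }.

(* H^1 = H x R.  The alias is needed because the library norms [H * R] by the
   maximum. *)
Definition hext (R : realType) (H : finHilbertType R) : Type := (H * R^o)%type.

Section Hext.
Context {R : realType} {H : finHilbertType R}.

HB.instance Definition _ := GRing.Lmodule.copy (hext H) (H * R^o)%type.

Let norm1 (z : hext H) : R := Num.sqrt (`|z.1| ^+ 2 + z.2 ^+ 2).

Let norm1D (y z : hext H) : norm1 (y + z) <= norm1 y + norm1 z.
Proof.
case: y z => [x r] [y s]; rewrite /norm1 /=.
set u := Num.sqrt (`|x| ^+ 2 + _); set v := Num.sqrt (`|y| ^+ 2 + _).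
have u0 : 0 <= u by exact: sqrtr_ge0.
have v0 : 0 <= v by exact: sqrtr_ge0.
have uE : u ^+ 2 = `|x| ^+ 2 + r ^+ 2.
  by rewrite /u sqr_sqrtr// addr_ge0// sqr_ge0.
have vE : v ^+ 2 = `|y| ^+ 2 + s ^+ 2.
  by rewrite /v sqr_sqrtr// addr_ge0// sqr_ge0.
have cs : `|x| * `|y| + r * s <= u * v.
  rewrite (le_trans (ler_norm _))// -(@ler_pXn2r _ 2)// ?nnegrE ?mulr_ge0//.
  rewrite real_normK ?num_real// exprMn uE vE.
  have := sqr_ge0 (`|x| * s - `|y| * r); nra.
rewrite -(ler_pXn2r (ltn0Sn 1)) ?nnegrE ?addr_ge0 ?sqrtr_ge0//.
rewrite sqr_sqrtr ?addr_ge0 ?sqr_ge0//.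
have : `|x + y| ^+ 2 <= (`|x| + `|y|) ^+ 2.
  by rewrite ler_pXn2r ?nnegrE ?addr_ge0 ?ler_normD.
nra.
Qed.

Let norm1Z (a : R) (z : hext H) : norm1 (a *: z) = `|a| * norm1 z.
Proof.
case: z => x r; rewrite /norm1 /= normrZ.
rewrite (_ : (a *: (r : R^o)) = a * r)// !exprMn real_normK ?num_real//.
by rewrite -mulrDr sqrtrM ?sqr_ge0// sqrtr_sqr.
Qed.

Let norm1_eq0 (z : hext H) : norm1 z = 0 -> z = 0.
Proof.
case: z => x r /eqP; rewrite /norm1 sqrtr_eq0 /= => h.
have hx := sqr_ge0 `|x|; have hr := sqr_ge0 r.
have /eqP : `|x| ^+ 2 = 0 by lra.
have /eqP : r ^+ 2 = 0 by lra.
by rewrite !sqrf_eq0 normr_eq0 => /eqP -> /eqP ->.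
Qed.

HB.instance Definition _ :=
  Lmodule_isNormed.Build R (hext H) norm1D norm1Z norm1_eq0.

HB.instance Definition _ := Vector.copy (hext H) (H * R^o)%type.

Let dot1 (y z : hext H) : R := hdot y.1 z.1 + y.2 * z.2.

Let dot1C y z : dot1 y z = dot1 z y.
Proof. by rewrite /dot1 hdotC (mulrC y.2). Qed.

Let dot1Dl x y z : dot1 (x + y) z = dot1 x z + dot1 y z.
Proof. by rewrite /dot1 /= hdotDl mulrDl addrACA. Qed.

Let dot1Zl (a : R) y z : dot1 (a *: y) z = a * dot1 y z.
Proof.
rewrite /dot1 /= hdotZl (_ : a *: y.2 = a * y.2)//.
by rewrite -mulrA mulrDr.
Qed.

Lemma hext_normE (z : hext H) : `|z| = Num.sqrt (`|z.1| ^+ 2 + z.2 ^+ 2).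
Proof. by []. Qed.

Let dot1xx z : dot1 z z = `|z| ^+ 2.
Proof.
by rewrite hext_normE sqr_sqrtr ?addr_ge0 ?sqr_ge0// /dot1 hdotxx -expr2.
Qed.

HB.instance Definition _ :=
  NormedModule_isHilbert.Build R (hext H) dot1C dot1Dl dot1Zl dot1xx.

End Hext.

Definition nonzero (R : realType) (H : normedModType R) := {x : H | x != 0}.

Section Projective.
Context {R : realType} {H : normedModType R}.
Implicit Types x y z : nonzero H.

Definition collinear x y : bool :=
  `[< exists2 c : R, c != 0 & \val y = c *: \val x >].

Let collinear_equiv : equiv_class_of collinear.
Proof.
split=> [x|x y|y x z].
- by apply/asboolP; exists 1; rewrite ?oner_neq0 ?scale1r.
- apply/asboolP/asboolP => -[c c0 e]; exists c^-1; rewrite ?invr_eq0//.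
  + by rewrite e scalerA mulVf ?scale1r.
  + by rewrite e scalerA mulVf ?scale1r.
- move=> /asboolP[c c0 ey] /asboolP[b b0 ez]; apply/asboolP.
  by exists (b * c); rewrite ?mulf_neq0// ez ey scalerA.
Qed.

Canonical collinear_equivRel := EquivRelPack collinear_equiv.

Definition projective : Type := {eq_quot collinear_equivRel}.

HB.instance Definition _ := Choice.on projective.

Definition proj_pt (v : H) (v0 : v != 0) : projective :=
  \pi_({eq_quot collinear_equivRel}) (exist _ v v0 : nonzero H).

Definition proj_rep (p : projective) : H :=
  \val (repr (p : {eq_quot collinear_equivRel})).

Lemma proj_rep_neq0 (p : projective) : proj_rep p != 0.
Proof. by rewrite /proj_rep; case: (repr _). Qed.

Lemma proj_ptK (p : projective) : proj_pt (proj_rep_neq0 p) = p.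
Proof.
rewrite /proj_pt -[RHS](reprK (p : {eq_quot collinear_equivRel})).
by congr \pi; exact: val_inj.
Qed.

Lemma proj_ptP (v w : H) (v0 : v != 0) (w0 : w != 0) :
  proj_pt v0 = proj_pt w0 <-> exists2 c : R, c != 0 & w = c *: v.
Proof.
have e := @eqquotP _ collinear_equivRel {eq_quot collinear_equivRel}
  (exist _ v v0) (exist _ w w0).
by split=> [/e/asboolP|h]; last exact/e/asboolP.
Qed.

Definition proj_dist_at (v w : H) : R :=
  Num.min `|(`|v|^-1 *: v) - (`|w|^-1 *: w)| `|(`|v|^-1 *: v) + (`|w|^-1 *: w)|.

Definition proj_dist (p q : projective) : R :=
  proj_dist_at (proj_rep p) (proj_rep q).

Let unit_vec (v : H) : H := `|v|^-1 *: v.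

Let unit_vecZ (c : R) (v : H) : c != 0 ->
  unit_vec (c *: v) = unit_vec v \/ unit_vec (c *: v) = - unit_vec v.
Proof.
move=> c0; rewrite /unit_vec normrZ invfM scalerA.
have [c_gt0|c_lt0|c_eq0] := ltrgt0P c.
- by left; rewrite mulrAC mulVf ?mul1r.
- by right; rewrite invrN mulrAC mulNr mulVf// mulN1r scaleNr.
- by rewrite c_eq0 eqxx in c0.
Qed.

Let proj_dist_atC (v w : H) : proj_dist_at v w = proj_dist_at w v.
Proof. by rewrite /proj_dist_at distrC (addrC (_ *: v)). Qed.

Let proj_dist_atZ (c : R) (v w : H) : c != 0 ->
  proj_dist_at (c *: v) w = proj_dist_at v w.
Proof.
move=> /(unit_vecZ v); rewrite /proj_dist_at -/(unit_vec _) -/(unit_vec v).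
rewrite -/(unit_vec w) => -[-> //|->].
by rewrite minC -opprD normrN addrC distrC.
Qed.

Let proj_rep_pt (v : H) (v0 : v != 0) :
  exists2 c : R, c != 0 & proj_rep (proj_pt v0) = c *: v.
Proof. by apply/(proj_ptP v0 (proj_rep_neq0 _)); rewrite proj_ptK. Qed.

Lemma proj_distE (v w : H) (v0 : v != 0) (w0 : w != 0) :
  proj_dist (proj_pt v0) (proj_pt w0) =
  Num.min `|(`|v|^-1 *: v) - (`|w|^-1 *: w)| `|(`|v|^-1 *: v) + (`|w|^-1 *: w)|.
Proof.
rewrite /proj_dist; have [c c0 ->] := proj_rep_pt v0.
have [b b0 ->] := proj_rep_pt w0.
by rewrite proj_dist_atZ// proj_dist_atC proj_dist_atZ// proj_dist_atC.
Qed.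

Let proj_distxx (p : projective) : proj_dist p p = 0.
Proof. by rewrite /proj_dist /proj_dist_at subrr normr0 min_l. Qed.

Let proj_dist_sym (p q : projective) : proj_dist p q = proj_dist q p.
Proof. exact: proj_dist_atC. Qed.

Let proj_dist_eq0 (p q : projective) : proj_dist p q = 0 -> p = q.
Proof.
have p0 := proj_rep_neq0 p; have q0 := proj_rep_neq0 q => h.
rewrite -(proj_ptK p) -(proj_ptK q); apply/proj_ptP.
have np : `|proj_rep p| != 0 by rewrite normr_eq0.
have nq : `|proj_rep q| != 0 by rewrite normr_eq0.
have [e|e] : unit_vec (proj_rep q) = unit_vec (proj_rep p) \/
             unit_vec (proj_rep q) = - unit_vec (proj_rep p).
- move: h; rewrite /proj_dist /proj_dist_at /Num.min.
  case: ifP => _ /eqP; rewrite normr_eq0.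
    by rewrite subr_eq0 => /eqP h; left; rewrite /unit_vec h.
  by rewrite addrC addr_eq0 => /eqP h; right; rewrite /unit_vec h.
- exists (`|proj_rep q| / `|proj_rep p|); first by rewrite mulf_neq0 ?invr_eq0.
  by rewrite -scalerA -/(unit_vec _) -e scalerA divff ?scale1r.
- exists (- (`|proj_rep q| / `|proj_rep p|)).
    by rewrite oppr_eq0 mulf_neq0 ?invr_eq0.
  by rewrite scaleNr -scalerA -/(unit_vec _) -scalerN -e scalerA divff ?scale1r.
Qed.

Let proj_dist_triangle (q p r : projective) :
  proj_dist p r <= proj_dist p q + proj_dist q r.
Proof.
rewrite /proj_dist /proj_dist_at -!/(unit_vec _).
set a := unit_vec (proj_rep p); set b := unit_vec (proj_rep q).
set c := unit_vec (proj_rep r).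
have h1 := ler_distD b a c.
have h2 := ler_distD (- b) a (- c).
have h3 := ler_distD b a (- c).
have h4 := ler_distD (- b) a c.
have e : `|- b - c| = `|b + c| by rewrite -opprD normrN.
have e' : `|- b + c| = `|b - c| by rewrite addrC distrC.
rewrite !opprK e e' in h1 h2 h3 h4.
by rewrite ge_min /Num.min; do 2 case: ifP => _; apply/orP;
  [left|right|right|left].
Qed.

HB.instance Definition _ := isMetric.Build R projective
  proj_distxx proj_dist_eq0 proj_dist_sym proj_dist_triangle.

End Projective.
Arguments projective {R} H.
Arguments collinear_equivRel {R} H.

Definition skew_product (R : realType) (B H : Type) (theta : R -> B -> B)
    (phi : R -> B -> H -> H) (t : R) (z : B * H) : B * H :=
  (theta t z.1, phi t z.1 z.2).

Section LinearFlows.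
Context {R : realType} {B : metricType R} {H : finHilbertType R}.
Variables (theta : R -> B -> B) (phi : R -> B -> H -> H).

Definition linear_flow :=
  is_flow (skew_product theta phi) /\ forall t b, linear (phi t b).

(* For a linear flow the [None] branch is never taken; see [proj_flowE]. *)
Definition proj_flow (t : R) (z : B * projective H) : B * projective H :=
  (theta t z.1,
   if insub (phi t z.1 (proj_rep z.2)) is Some y
   then proj_pt (valP (y : nonzero H)) else z.2).

End LinearFlows.

Section SelgradeBundles.
Context {R : realType} {B : metricType R} {H : finHilbertType R}.

Definition selgrade_bundle (M : set (B * projective H)) : set (B * H) :=
  [set z | forall x0 : z.2 != 0, M (z.1, proj_pt x0)].

Definition proj_set (V : set (B * H)) : set (B * projective H) :=
  [set p | exists b x (x0 : x != 0), V (b, x) /\ p = (b, proj_pt x0)].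

Definition prod_zero (V : set (B * H)) : set (B * hext H) :=
  [set (z.1, (z.2, 0) : hext H) | z in V].

End SelgradeBundles.

(* H-valued integrals are weak: tested against all vectors, which in finite
   dimension is the usual integral.  For t < 0 the integral from 0 to t is minus
   the one over [t, 0]. *)

Section Integral.
Context {R : realType} {H : finHilbertType R}.
Local Notation mu := (@lebesgue_measure R).

Definition oriented_integral (g : R -> R) (t : R) : R :=
  if 0 <= t then \int[mu]_(s in `[0, t]) g s else - \int[mu]_(s in `[t, 0]) g s.

Definition is_integral (F : R -> H) (t : R) (v : H) := forall w : H,
  mu.-integrable `[Num.min 0 t, Num.max 0 t]
    (EFin \o (fun s => hdot (F s) w)) /\
  hdot v w = oriented_integral (fun s => hdot (F s) w) t.

Definition vintegral (F : R -> H) (t : R) : H := get (is_integral F t).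

(* Functions representing the elements of L^oo(R, H). *)
Definition Linfty (g : R -> H) :=
  measurable_fun [set: R] (g : R -> g_sigma_algebraType (@open H)) /\
  exists K : R, {ae mu, forall t, `|g t| <= K}.

End Integral.

Section AffineFlows.
Context {R : realType} {B : metricType R} {H : finHilbertType R}.
Variables (theta : R -> B -> B) (phi : R -> B -> H -> H) (f : B -> R -> H).
Local Notation mu := (@lebesgue_measure R).

Definition affine_forcing (t : R) (b : B) : H :=
  vintegral (fun s => phi (t - s) (theta s b) (f b s)) t.

(* The linear part is [skew_product theta phi].  The iterated almost-everywhere
   condition says f(b)(. + s) = f(theta_s b) in L^oo for almost all [s]; unlike
   a condition for almost all pairs (t, s), it does not depend on the chosen
   representatives. *)
Definition affine_flow (psi : R -> B -> H -> H) :=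
  [/\ continuous (fun p : R * (B * H) => skew_product theta psi p.1 p.2),
      linear_flow theta phi,
      forall b, Linfty (f b),
      forall b, {ae mu, forall s,
        {ae mu, forall t, f b (t + s) = f (theta s b) t}} &
      forall t b x, psi t b x = phi t b x + affine_forcing t b].

Definition affine_lift (t : R) (b : B) (z : hext H) : hext H :=
  (phi t b z.1 + z.2 *: affine_forcing t b, z.2).

End AffineFlows.

Section Projectivization.
Context {R : realType} {B : metricType R} {H : finHilbertType R}.

Lemma hext0_neq0 (x : H) : x != 0 -> ((x, 0) : hext H) != 0.
Proof. by apply: contra_neq => -[]. Qed.

Lemma hext1_neq0 (x : H) (r : R) : r != 0 -> ((x, r) : hext H) != 0.
Proof. by apply: contra_neq => -[]. Qed.

Definition proj10 : set (projective (hext H)) :=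
  [set p | exists x (x0 : x != 0), p = proj_pt (hext0_neq0 x0)].

Definition proj11 : set (projective (hext H)) :=
  [set p | exists x r (r0 : r != 0), p = proj_pt (hext1_neq0 x r0)].

Definition Bproj10 : set (B * projective (hext H)) := [set: B] `*` proj10.
Definition Bproj11 : set (B * projective (hext H)) := [set: B] `*` proj11.

Lemma h0_subproof (z : B * projective H) :
  (z.1, proj_pt (hext0_neq0 (proj_rep_neq0 z.2))) \in Bproj10.
Proof.
by apply/mem_set; split=> //; exists (proj_rep z.2), (proj_rep_neq0 z.2).
Qed.

Definition h0 (z : B * projective H) : Bproj10 := SigSub (h0_subproof z).

Lemma h1_subproof (z : B * H) :
  (z.1, proj_pt (hext1_neq0 z.2 (oner_neq0 R))) \in Bproj11.
Proof. by apply/mem_set; split=> //; exists z.2, 1, (oner_neq0 R). Qed.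

Definition h1 (z : B * H) : Bproj11 := SigSub (h1_subproof z).

Lemma h0E (b : B) (x : H) (x0 : x != 0) :
  \val (h0 (b, proj_pt x0)) = (b, proj_pt (hext0_neq0 x0)).
Proof.
congr pair; apply/proj_ptP => /=.
have [c c0 e] := (proj_ptP (proj_rep_neq0 _) x0).1 (proj_ptK (proj_pt x0)).
exists c => //; apply: (etrans (congr1 (fun u => (u, 0 : R^o)) e)).
by congr pair; exact: (esym (mulr0 c)).
Qed.

Lemma proj_flowE (theta : R -> B -> B) (phi : R -> B -> H -> H) t b x
    (x0 : x != 0) (y0 : phi t b x != 0) : linear_flow theta phi ->
  proj_flow theta phi t (b, proj_pt x0) = (theta t b, proj_pt y0).
Proof.
move=> [_ lphi]; congr pair => /=.
have [c c0 e] := (proj_ptP x0 (proj_rep_neq0 _)).1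
  (esym (proj_ptK (proj_pt x0))).
have phiZ a (v : H) : phi t b (a *: v) = a *: phi t b v.
  have h0' : phi t b 0 = 0.
    have := lphi t b 1 0 0; rewrite !scale1r addr0 => /eqP.
    by rewrite -subr_eq subrr eq_sym => /eqP.
  by have := lphi t b a v 0; rewrite h0' !addr0.
case: insubP => [y _ /= ey|]; last first.
  by rewrite e phiZ negbK scaler_eq0 (negPf c0) (negPf y0).
apply/proj_ptP; exists c^-1; rewrite ?invr_eq0//.
by rewrite ey e phiZ scalerA mulVf ?scale1r.
Qed.

Section Invariance.
Variables (theta : R -> B -> B) (phi : R -> B -> H -> H) (f : B -> R -> H).
Local Notation PPsi := (proj_flow theta (affine_lift theta phi f)).

Lemma Bproj10_inv t z : Bproj10 z -> Bproj10 (PPsi t z).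
Proof.
case: z => b p [_ [x [x0 /= ep]]]; split=> //=.
have [c c0 e] := (proj_ptP (hext0_neq0 x0) (proj_rep_neq0 p)).1
  (etrans (esym ep) (esym (proj_ptK p))).
case: insubP => [[[y r] yr0] _ /= ey|_]; last by exists x, x0.
have r0 : r = 0.
  by move: ey => [_ ->]; rewrite e /= (_ : c *: (0 : R^o) = c * 0)// mulr0.
rewrite r0 in yr0 ey *.
have y0 : y != 0 by apply: contraNneq yr0 => ->.
by exists y, y0; apply/proj_ptP; exists 1; rewrite ?oner_neq0 ?scale1r.
Qed.

Lemma Bproj11_inv t z : Bproj11 z -> Bproj11 (PPsi t z).
Proof.
case: z => b p [_ [x [r [r0 /= ep]]]]; split=> //=.
have [c c0 e] := (proj_ptP (hext1_neq0 x r0) (proj_rep_neq0 p)).1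
  (etrans (esym ep) (esym (proj_ptK p))).
case: insubP => [[[y s] ys0] _ /= ey|_]; last by exists x, r, r0.
have s0 : s != 0 by move: ey => [_ ->]; rewrite e /= mulf_neq0.
by exists y, s, s0; apply/proj_ptP; exists 1; rewrite ?oner_neq0 ?scale1r.
Qed.

Definition PPsi10 := restrict_flow Bproj10_inv.
Definition PPsi11 := restrict_flow Bproj11_inv.

End Invariance.
End Projectivization.

(* Main.v *)
Require Import Defs.
From mathcomp Require Import all_boot all_order all_algebra.
From mathcomp Require Import all_classical all_reals all_analysis.
From mathcomp Require Import ring lra measurable_realfun.
Set Implicit Arguments.
Unset Strict Implicit.
Unset Printing Implicit Defensive.
Import Order.TTheory GRing.Theory Num.Theory.
Import numFieldNormedType.Exports.
Import VectorInternalTheory.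
Local Open Scope classical_set_scope.
Local Open Scope ring_scope.

(* The map h^0 is an isometry intertwining the flows, so it carries chains, limit
   sets, chain recurrent components and their order along.  For h^1 the factor 2
   comes from |x/|x| - y/|y|| <= 2 |x - y| / |y| applied to (x, 1) and (y, 1),
   whose norms are at least 1.  Since P(x, 1) = P(x/|x|, 1/|x|), an unbounded set
   C gives, by compactness of B and of the unit sphere, limit points of h^1(C) in
   B x P H^{1,0}; if |x| <= K on C, the last coordinate keeps h^1(C) at distance
   at least 1/(K+1) from that set.

   The least formal point is that Psi is a flow.  The invariance of f holds for
   almost every s only, so integration yields the cocycle identity
     F(t + s, b) = phi(t, theta_s b, F(s, b)) + F(t, theta_s b)
   of the forcing term for almost every s.  As F(t, b) = psi(t, b, 0) is
   continuous, the identity extends to every s. *)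

(** * Continuity of pairs, compositions and finite sums *)

Lemma continuous_pair {T U V : topologicalType} (f : T -> U) (g : T -> V) :
  continuous f -> continuous g -> continuous (fun x => (f x, g x)).
Proof.
move=> cf cg x.
exact: (@cvg_pair T U V _ (nbhs (f x)) (nbhs (g x)) _ _ _ f g (cf x) (cg x)).
Qed.

Lemma continuousT_comp {T U V : topologicalType} (f : T -> U) (g : U -> V) :
  continuous f -> continuous g -> continuous (fun x => g (f x)).
Proof. by move=> cf cg x; apply: cvg_comp (cf x) (cg (f x)). Qed.

Lemma continuous_fst {T U : topologicalType} : continuous (@fst T U).
Proof. by move=> x; exact: cvg_fst. Qed.

Lemma continuous_snd {T U : topologicalType} : continuous (@snd T U).
Proof. by move=> x; exact: cvg_snd. Qed.

Lemma continuous_id {T : topologicalType} : continuous (fun x : T => x).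
Proof. by move=> x; exact: cvg_id. Qed.

Lemma continuous_cst {T U : topologicalType} (u : U) : continuous (fun _ : T => u).
Proof. by move=> x; exact: cvg_cst. Qed.

Lemma cvg_bigsum {R : realType} {V : normedModType R} {T I : Type}
    (G : set_system T) {FG : Filter G} (r : seq I) (F : I -> T -> V) (l : I -> V) :
  (forall i, F i y @[y --> G] --> l i) ->
  \sum_(i <- r) F i y @[y --> G] --> \sum_(i <- r) l i.
Proof.
move=> h; elim: r => [|i r ih].
  under eq_fun do rewrite big_nil.
  by rewrite big_nil; exact: cvg_cst.
under eq_fun do rewrite big_cons.
by rewrite big_cons; exact: cvgD (h i) ih.
Qed.

(** * Finite-dimensional spaces *)

Section FiniteDimension.
Context {R : realType} {H : finHilbertType R}.
Local Notation n := (dim H).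

Lemma r2v_sum (a : 'rV[R]_n) :
  r2v a = \sum_i a ord0 i *: (r2v (delta_mx 0 i) : H).
Proof.
by rewrite {1}(row_sum_delta a) linear_sum; under eq_bigr do rewrite linearZ.
Qed.

Lemma r2v_continuous : continuous (r2v : 'rV[R]_n -> H).
Proof.
move=> a; rewrite (_ : r2v = fun a : 'rV[R]_n =>
  \sum_i a ord0 i *: (r2v (delta_mx 0 i) : H)); last first.
  by apply/funext => ?; rewrite r2v_sum.
apply: (@cvg_bigsum _ _ _ _ (nbhs a)) => i; apply: cvgZr_tmp; exact: coord_continuous.
Qed.

(* The unit sphere of R^n is compact, so its image under the injective map r2v
   stays away from 0. *)
Lemma v2r_bounded : exists2 K : R, 0 < K & forall x : H, `|v2r x| <= K * `|x|.
Proof.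
pose S : set 'rV[R]_n := [set a | `|a| = 1].
have cS : compact S.
  apply: bounded_closed_compact.
    exists 1; split => // M M1 a Sa; have a1 : `|a| <= 1.
      by rewrite le_eqVlt; apply/orP; left; apply/eqP.
    exact: le_trans a1 (ltW M1).
  rewrite (_ : S = (fun a => `|a|) @^-1` [set 1])//.
  by apply: (preimage_closed (fun x _ => @norm_continuous _ _ x)); exact: closed_eq.
have cLS : compact (r2v @` S : set H).
  apply: continuous_compact => //; apply: continuous_subspaceT.
  exact: r2v_continuous.
have clLS : closed (r2v @` S : set H).
  by apply: compact_closed => //; exact: norm_hausdorff.
have : nbhs (0 : H) (~` (r2v @` S)).
  apply: open_nbhs_nbhs; split; first exact: closed_openC.
  move=> [a Sa a0]; have : a = 0 by rewrite -[a]r2vK a0 linear0.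
  by move=> a00; move: Sa; rewrite /S /= a00 normr0 => /eqP; rewrite eq_sym oner_eq0.
move=> /nbhs_ballP[e /= e0 he]; exists e^-1; first by rewrite invr_gt0.
move=> x; rewrite mulrC ler_pdivlMr// leNgt; apply/negP => xe.
have [x0|x0] := eqVneq (v2r x) 0.
  by move: xe; rewrite x0 normr0 mul0r ltNge normr_ge0.
have nx0 : 0 < `|v2r x| by rewrite normr_gt0.
(* If the bound failed at [x], this rescaled vector would lie in the ball that misses the image of
   the sphere, yet it is the image of a unit vector of R^n. *)
apply: (he (`|v2r x|^-1 *: x)).
  rewrite -ball_normE /= sub0r normrN normrZ normfV normr_id.
  by rewrite mulrC ltr_pdivrMr// mulrC.
exists (`|v2r x|^-1 *: v2r x); last by rewrite linearZ/= v2rK.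
by rewrite /S /= normrZ normfV normr_id mulVf// gt_eqF.
Qed.

Lemma v2r_continuous : continuous (v2r : H -> 'rV[R]_n).
Proof.
have [K K0 hK] := v2r_bounded.
move=> x; apply/cvgrPdist_le => e e0; near=> y.
rewrite -linearB (le_trans (hK _))// -ler_pdivlMl//; near: y.
by apply: cvgr_dist_le => //; rewrite mulr_gt0// invr_gt0.
Unshelve. all: by end_near. Qed.

(** In coordinates the sphere of the norm of H is closed, since [r2v] is continuous, and bounded by
    [v2r_bounded]; its compactness in R^n is pushed forward to H. *)
Lemma compact_sphere : compact [set x : H | `|x| = 1].
Proof.
have [K K0 hK] := v2r_bounded.
pose S : set 'rV[R]_n := [set a | `|r2v a : H| = 1].
rewrite (_ : mkset _ = r2v @` S); last first.
  apply/seteqP; split=> [x /= x1|x [a + <-]//].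
  by exists (v2r x); rewrite /S /= ?v2rK.
apply: continuous_compact.
  by apply: continuous_subspaceT; exact: r2v_continuous.
apply: bounded_closed_compact.
  exists K; split; first exact: num_real.
  move=> M KM a /= Sa; apply/ltW/le_lt_trans/KM.
  by have := hK (r2v a); rewrite r2vK Sa mulr1.
rewrite (_ : S = (fun a => `|r2v a : H|) @^-1` [set 1])//.
apply: preimage_closed; last exact: closed_eq.
by move=> a _; apply: continuous_comp; [exact: r2v_continuous|exact: norm_continuous].
Qed.

Implicit Types x y z : H.

Lemma hdot0l x : hdot 0 x = 0.
Proof. by rewrite -(scale0r (0 : H)) hdotZl mul0r. Qed.

Lemma hdot_suml (I : Type) (r : seq I) (F : I -> H) x :
  hdot (\sum_(i <- r) F i) x = \sum_(i <- r) hdot (F i) x.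
Proof.
elim: r => [|i r ih]; first by rewrite !big_nil hdot0l.
by rewrite !big_cons hdotDl ih.
Qed.

(** This makes weak integrals unique, so that [vintegral] is known once a single candidate passes
    all tests. *)
Lemma hdot_inj x y : (forall w, hdot x w = hdot y w) -> x = y.
Proof.
move=> h; apply/eqP; rewrite -subr_eq0 -normr_eq0 -sqrf_eq0 -hdotxx.
by rewrite hdotDl h -hdotDl subrr hdot0l.
Qed.

End FiniteDimension.

(** * Integration *)

Section OrientedIntegral.
Context {R : realType}.
Local Notation mu := (@lebesgue_measure R).
Implicit Types (g : R -> R) (a b s t : R).

(** The class in which coordinates of the integrands are handled; it is stable under translation,
    finite sums and continuous factors. *)
Definition locally_integrable g :=
  measurable_fun [set: R] g /\ forall a b, mu.-integrable `[a, b] (EFin \o g).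

Lemma preimage_shift_itv s (b1 b2 : bool) a b :
  (fun x => x + s) @^-1` [set` Interval (BSide b1 a) (BSide b2 b)] =
  [set` Interval (BSide b1 (a - s)) (BSide b2 (b - s))].
Proof.
by apply/seteqP; split => x /=; case: b1; case: b2;
  rewrite !in_itv /= ?(lerBlDr, lerBrDr, ltrBlDr, ltrBrDr).
Qed.

Local Notation shift s := ((fun x => x + s) : _ -> measurableTypeR R).

Lemma measurable_shift s : measurable_fun [set: R] (shift s).
Proof. exact: measurable_funD. Qed.

(** The translated measure gives every half-open interval its length, and this property
    characterizes Lebesgue measure. *)
Lemma lebesgue_measure_shift s (A : set R) : measurable A ->
  pushforward mu (shift s) A = mu A.
Proof.
move=> mA; apply/esym/lebesgue_measure_unique => //=.
  exact: measurable_shift.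
move=> ms _ [[a b] _ <-].
rewrite /pushforward /= preimage_shift_itv !lebesgue_measure_itv /= !lte_fin.
by rewrite ltrD2r -!EFinB (_ : b - s - (a - s) = b - a)//; ring.
Qed.

Let integral_shiftE s (D : set R) (k : R -> \bar R) :
  (\int[mu]_(x in D) k x = \int[pushforward mu (shift s)]_(x in D) k x)%E.
Proof.
apply: eq_measure_integral; first exact: measurable_shift.
by move=> ms A mA _; exact/esym/lebesgue_measure_shift.
Qed.

Let preimage_shift_segment s a b :
  (shift s) @^-1` `[a + s, b + s]%classic = `[a, b]%classic.
Proof. by rewrite preimage_shift_itv !addrK. Qed.

Lemma locally_integrable_shift g s : locally_integrable g ->
  locally_integrable (fun x => g (x + s)).
Proof.
move=> [mg ig]; have ms := measurable_shift s.
split=> [|a b]; first exact: measurableT_comp.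
have mgE : measurable_fun [set: R] (EFin \o g) by exact/measurable_EFinP.
apply/integrableP; split.
  by apply/measurable_EFinP/measurable_funTS/measurableT_comp.
have /integrableP[_] := ig (a + s) (b + s).
rewrite (integral_shiftE s) ge0_integral_pushforward ?preimage_shift_segment//.
by apply/measurable_funTS/measurableT_comp.
Qed.

Lemma Rintegral_shift g s a b : locally_integrable g ->
  \int[mu]_(x in `[a, b]) g (x + s) = \int[mu]_(x in `[a + s, b + s]) g x.
Proof.
move=> lg; have [mg ig] := lg; rewrite /Rintegral; congr fine.
have ms := measurable_shift s.
rewrite [RHS](integral_shiftE s) integral_pushforward ?preimage_shift_segment//.
- exact/measurable_EFinP.
- by have [_] := locally_integrable_shift s lg; exact.
Qed.

(** The sign convention for negative times makes [oriented_integral] additive wherever 0 lies: left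
    of the segment, inside it or to its right. *)
Lemma Rintegral_itvE g a b : locally_integrable g -> a <= b ->
  \int[mu]_(x in `[a, b]) g x = oriented_integral g b - oriented_integral g a.
Proof.
move=> [_ ig] ab.
have split3 x y z : x <= y -> y <= z -> \int[mu]_(u in `[x, z]) g u =
    \int[mu]_(u in `[x, y]) g u + \int[mu]_(u in `[y, z]) g u.
  move=> xy yz; apply/eqP; rewrite addrC -subr_eq.
  rewrite (@Rintegral_itvB _ g (BLeft x) (BRight z) y) ?bnd_simp//.
  (* The remainder is open at [y]; adding this endpoint changes nothing, as a point has measure
     zero. *)
  rewrite Rintegral_itv_obnd_cbnd//.
  by apply: integrableS (ig y z) => //; exact: subset_itv_oc_cc.
rewrite /oriented_integral; case: (leP 0 a) => a0.
  by rewrite (le_trans a0 ab) (split3 0 a b)// addrAC subrr add0r.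
case: (leP 0 b) => b0; first by rewrite (split3 a 0 b) ?(ltW a0)// opprK addrC.
by rewrite (split3 a b 0) ?(ltW b0)// opprK [X in _ = _ + X]addrC addKr.
Qed.

(** The substitution moves the bounds 0 and [t] to [s] and [t + s]; this is the source of the two
    terms in the cocycle identity of the forcing. *)
Lemma oriented_integral_shift g s t : locally_integrable g ->
  oriented_integral (fun x => g (x + s)) t =
  oriented_integral g (t + s) - oriented_integral g s.
Proof.
move=> lg; rewrite {1}/oriented_integral; case: (leP 0 t) => t0;
  rewrite Rintegral_shift// add0r Rintegral_itvE ?ler_wnDl ?ler_wpDl// ?ltW//.
  by rewrite opprB.
Qed.

Lemma eq_ae_oriented_integral g1 g2 t : locally_integrable g1 ->
  locally_integrable g2 -> {ae mu, forall x, g1 x = g2 x} ->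
  oriented_integral g1 t = oriented_integral g2 t.
Proof.
move=> [m1 _] [m2 _] e12.
have E (D : set R) : measurable D ->
    \int[mu]_(x in D) g1 x = \int[mu]_(x in D) g2 x.
  move=> mD; congr fine; apply: ae_eq_integral => //.
  - exact/measurable_EFinP/measurable_funTS.
  - exact/measurable_EFinP/measurable_funTS.
  - by apply: (@filterS _ (almost_everywhere mu)) e12 => x e _; rewrite e.
by rewrite /oriented_integral !E.
Qed.

(** On each segment the continuous factor is bounded, by compactness. *)
Lemma locally_integrable_continuousM g (h : R -> R) : continuous h ->
  locally_integrable g -> locally_integrable (fun x => h x * g x).
Proof.
move=> ch [mg ig]; have mh := continuous_measurable_fun ch.
split=> [|a b]; first exact: measurable_funM.
apply: (@integrableMr _ _ _ mu _ _ h (EFin \o g)) => //.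
- exact: measurable_funTS.
- have /compact_bounded[M [_ hM]] : compact (h @` `[a, b]).
    by apply: continuous_compact; [exact: continuous_subspaceT|exact: segment_compact].
  by exists M; split; rewrite ?num_real // => N MN x abx; apply: hM => //; exists x.
Qed.

Lemma locally_integrable_sum (I : Type) (r : seq I) (F : I -> R -> R) :
  (forall i, locally_integrable (F i)) ->
  locally_integrable (fun x => \sum_(i <- r) F i x).
Proof.
move=> lF; split=> [|a b].
  by apply: measurable_sum => i; have [] := lF i.
rewrite (_ : _ \o _ = fun x => (\sum_(i <- r) (F i x)%:E)%E).
  by apply: integrable_sum => // i _; have [_] := lF i; exact.
by apply/funext => x /=; rewrite sumEFin.
Qed.

Lemma locally_integrable_bounded g (K : R) : measurable_fun [set: R] g ->
  {ae mu, forall x, `|g x| <= K} -> locally_integrable g.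
Proof.
move=> mg gK; split=> // a b; apply/integrableP.
have mgE : measurable_fun [set: R] (EFin \o g) by exact/measurable_EFinP.
split; first exact: measurable_funTS.
apply: (@le_lt_trans _ _ (\int[mu]_(x in `[a, b]) `|K|%:E)%E).
  apply: ae_ge0_le_integral => //.
  - by apply/measurable_funTS/measurableT_comp.
  - have := gK; apply: (@filterS _ (almost_everywhere mu)) => x gKx _.
    by rewrite lee_fin (le_trans gKx)// ler_norm.
rewrite integral_cst//= lebesgue_measure_itv/= -EFinB.
by case: ifP => _; rewrite ?mule0 ?ltry// -EFinM ltry.
Qed.

Lemma oriented_integral_sumZ (I : Type) (r : seq I) (F : I -> R -> R)
    (c : I -> R) t : (forall i, locally_integrable (F i)) ->
  oriented_integral (fun x => \sum_(i <- r) F i x * c i) t =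
  \sum_(i <- r) oriented_integral (F i) t * c i.
Proof.
move=> lF.
have lFc i : locally_integrable (fun x => F i x * c i).
  under eq_fun do rewrite mulrC.
  by apply: locally_integrable_continuousM => // x; exact: cvg_cst.
have E x y : \int[mu]_(u in `[x, y]) (\sum_(i <- r) F i u * c i) =
    \sum_(i <- r) (\int[mu]_(u in `[x, y]) F i u) * c i.
  elim: r => [|i r ih].
    under eq_Rintegral do rewrite big_nil.
    by rewrite big_nil Rintegral_cst ?mul0r.
  under eq_Rintegral do rewrite big_cons.
  have [_ ii] := lFc i; have [_ iF] := lF i.
  rewrite big_cons RintegralD ?ih ?RintegralZr//.
  by have [_] := locally_integrable_sum r lFc; exact.
rewrite /oriented_integral; case: ifP => _; rewrite E// -sumrN.
by under eq_bigr do rewrite -mulNr.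
Qed.

End OrientedIntegral.

(** * Coordinates of the weak integral *)

Section VectorIntegral.
Context {R : realType} {H : finHilbertType R}.
Local Notation mu := (@lebesgue_measure R).
Implicit Types (F : R -> H) (t : R).
Local Notation basis i := (r2v (delta_mx 0 i) : H).

Lemma vec_sum (x : H) : x = \sum_i v2r x ord0 i *: basis i.
Proof. by rewrite -r2v_sum v2rK. Qed.

(** The vector [r2v a] of coordinate integrals passes every test, because testing against [w] is a
    linear combination of coordinates. Computations with [vintegral] thereby become scalar. *)
Lemma vintegral_coord F t :
  (forall i, locally_integrable (fun s => v2r (F s) ord0 i)) ->
  forall i, v2r (vintegral F t) ord0 i =
            oriented_integral (fun s => v2r (F s) ord0 i) t.
Proof.
move=> lF; set a := \row_i oriented_integral (fun s => v2r (F s) ord0 i) t.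
have dotE w : (fun s => hdot (F s) w) =
    fun s => \sum_i v2r (F s) ord0 i * hdot (basis i) w.
  apply/funext => s; rewrite {1}(vec_sum (F s)) hdot_suml.
  by under eq_bigr do rewrite hdotZl.
have iF : is_integral F t (r2v a).
  move=> w; split.
    rewrite dotE; have [|_] := @locally_integrable_sum R _ (index_enum _)
        (fun i s => v2r (F s) ord0 i * hdot (basis i) w); last exact.
    move=> i; under eq_fun do rewrite mulrC.
    by apply: locally_integrable_continuousM => // x; exact: cvg_cst.
  rewrite dotE oriented_integral_sumZ// r2v_sum hdot_suml.
  by apply: eq_bigr => i _; rewrite hdotZl mxE.
have vE : vintegral F t = r2v a.
  (* Since a weak integral exists, [get] returns one and not its default value. *)
  have jF : is_integral F t (vintegral F t) by apply: getPex; exists (r2v a).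
  by apply: hdot_inj => w; rewrite (jF w).2 (iF w).2.
by move=> i; rewrite vE r2vK mxE.
Qed.

End VectorIntegral.

Section AlmostEverywhere.
Context {R : realType}.
Local Notation mu := (@lebesgue_measure R).

(** Two continuous functions that differ at a point differ on a ball around it, and a ball has
    positive measure. *)
Lemma ae_eq_continuous (V : normedModType R) (u v : R -> V) :
  continuous u -> continuous v -> {ae mu, forall s, u s = v s} -> u = v.
Proof.
move=> cu cv [N [mN N0 uvN]]; apply/funext => s; apply/eqP; rewrite -subr_eq0.
apply: contrapT => /negP uvs0.
have : \forall x \near s, u x - v x != 0.
  exact: (cvgr_neq0 _ (cvgB (cu s) (cv s))) uvs0.
move=> /nbhs_ballP[e /= e0 se].
have : (mu (ball s e) <= mu N)%E.
  apply: le_measure; rewrite ?inE//; first exact: measurable_ball.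
  by move=> x /se uvx; apply: uvN => /= /eqP; rewrite -subr_eq0 (negPf uvx).
rewrite N0 lebesgue_measure_ball ?(ltW e0)// lee_fin leNgt.
by rewrite mulrn_wgt0.
Qed.

End AlmostEverywhere.

(** * Affine flows and their lifts *)

Section SkewProduct.
Context {R : realType} {B : metricType R} {H : finHilbertType R}.
Variables (theta : R -> B -> B) (phi : R -> B -> H -> H).
Hypothesis flow_phi : is_flow (skew_product theta phi).

Lemma skew_theta_continuous : continuous (fun p : R * B => theta p.1 p.2).
Proof.
have [cf _ _] := flow_phi.
apply: (continuousT_comp _ continuous_fst
  (f := fun p : R * B => skew_product theta phi p.1 (p.2, 0))).
apply: (continuousT_comp _ cf (f := fun p : R * B => (p.1, (p.2, 0 : H)))).
apply: continuous_pair; first exact: continuous_fst.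
by apply: continuous_pair; [exact: continuous_snd|exact: continuous_cst].
Qed.

Lemma skew_phi_continuous :
  continuous (fun p : R * (B * H) => phi p.1 p.2.1 p.2.2).
Proof.
by have [cf _ _] := flow_phi; exact: continuousT_comp cf continuous_snd.
Qed.

Lemma skew_theta0 b : theta 0 b = b.
Proof. by have [_ h _] := flow_phi; have [] := h (b, 0). Qed.

Lemma skew_thetaD t s b : theta (t + s) b = theta t (theta s b).
Proof. by have [_ _ h] := flow_phi; have [] := h t s (b, 0). Qed.

Lemma skew_phi0 b x : phi 0 b x = x.
Proof. by have [_ h _] := flow_phi; have [] := h (b, x). Qed.

Lemma skew_phiD t s b x : phi (t + s) b x = phi t (theta s b) (phi s b x).
Proof. by have [_ _ h] := flow_phi; have [] := h t s (b, x). Qed.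

End SkewProduct.

Section Linear.
Context {R : realType} {H : finHilbertType R}.
Variable (L : H -> H).
Hypothesis linL : linear L.

Lemma linear_fun0 : L 0 = 0.
Proof.
have := linL 1 0 0; rewrite !scale1r addr0 => /eqP.
by rewrite -subr_eq subrr eq_sym => /eqP.
Qed.

Lemma linear_funD x y : L (x + y) = L x + L y.
Proof. by rewrite -{1}[x]scale1r linL scale1r. Qed.

Lemma linear_funZ a x : L (a *: x) = a *: L x.
Proof. by rewrite -[a *: x]addr0 linL linear_fun0 addr0. Qed.

(** The matrix form of [L]. Applied to the integrand of the forcing it separates the matrix entries,
    continuous in time, from the coordinates of [f b], which are merely measurable. *)
Lemma linear_coord x i : v2r (L x) ord0 i =
  \sum_j v2r x ord0 j * v2r (L (r2v (delta_mx 0 j))) ord0 i.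
Proof.
rewrite {1}(vec_sum x).
elim/big_rec2 : _ => [|j y z _ <-].
  by rewrite linear_fun0 linear0 mxE.
by rewrite linL linearP/= !mxE.
Qed.

End Linear.

(** * The cocycle identity of the forcing term for almost every time *)

Section Forcing.
Context {R : realType} {B : metricType R} {H : finHilbertType R}.
Variables (theta : R -> B -> B) (phi psi : R -> B -> H -> H) (f : B -> R -> H).
Hypothesis affine_psi : affine_flow theta phi f psi.
Local Notation mu := (@lebesgue_measure R).
Local Notation forcing := (affine_forcing theta phi f).

Let flow_phi : is_flow (skew_product theta phi).
Proof. by have [_ []] := affine_psi. Qed.

Let linear_phi t b : linear (phi t b).
Proof. by have [_ [_ +]] := affine_psi; exact. Qed.

Lemma Linfty_coord (g : R -> H) i :
  Linfty g -> locally_integrable (fun s => v2r (g s) ord0 i).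
Proof.
move=> [mg [K gK]]; have [C C0 hC] := @v2r_bounded R H.
have coord_le (x : H) : `|v2r x ord0 i| <= C * `|x|.
  apply: le_trans (hC x).
  rewrite [leRHS]/Num.norm /= mx_normrE.
  by apply/bigmax_geP; right => /=; exists (ord0, i).
apply: (@locally_integrable_bounded _ _ (C * K)); last first.
  have := gK; apply: (@filterS _ (almost_everywhere mu)) => s gKs.
  by rewrite (le_trans (coord_le _))// ler_pM2l.
(* Open rays generate the Borel sets of R, and a coordinate map, being continuous, pulls them back
   to open sets of H. *)
apply: (measurability _ (RGenOInfty.measurableE R)) => // _ [_ [a ->] <-].
rewrite setTI (_ : _ @^-1` _ =
   g @^-1` ((fun x : H => v2r x ord0 i) @^-1` `]a, +oo[)) //.
rewrite -[X in measurable X]setTI; apply: mg => //.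
apply: sub_sigma_algebra; apply: open_comp; last exact: interval_open.
move=> x _; exact: (@continuousT_comp _ _ R v2r (fun y => y ord0 i)
  v2r_continuous (@coord_continuous _ _ _ ord0 i)).
Qed.

(** By [linear_coord] each coordinate is a finite sum of coordinates of [g] multiplied by continuous
    functions of [s]. *)
Lemma locally_integrable_forcing t b (g : R -> H) i : Linfty g ->
  locally_integrable (fun s => v2r (phi (t - s) (theta s b) (g s)) ord0 i).
Proof.
move=> Lg; under eq_fun do rewrite linear_coord//.
apply: locally_integrable_sum => j; under eq_fun do rewrite mulrC.
apply: locally_integrable_continuousM; last exact: Linfty_coord.
set e := r2v _.
have cphi : continuous (fun s => phi (t - s) (theta s b) e).
  apply: (continuousT_comp _ (skew_phi_continuous flow_phi)
    (f := fun s => (t - s, (theta s b, e)))).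
  apply: continuous_pair.
    by move=> s; apply: cvgB; [exact: cvg_cst|exact: cvg_id].
  apply: continuous_pair; last exact: continuous_cst.
  apply: (continuousT_comp _ (skew_theta_continuous flow_phi) (f := fun s => (s, b))).
  by apply: continuous_pair; [exact: continuous_id|exact: continuous_cst].
apply: (continuousT_comp (f := fun s => v2r (phi (t - s) (theta s b) e))
  (g := fun y => y ord0 i)); last exact: coord_continuous.
exact: continuousT_comp cphi v2r_continuous.
Qed.

(** The exceptional set of [s] is the one in the invariance of [f b], hence the same for all [t]. *)
Lemma ae_affine_forcingD b : {ae mu, forall s, forall t,
  forcing (t + s) b = phi t (theta s b) (forcing s b) + forcing t (theta s b)}.
Proof.
have [_ _ Lf cf _] := affine_psi.
have := cf b; apply: (@filterS _ (almost_everywhere mu)) => s fs t.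
apply: v2r_inj; rewrite linearD; apply/rowP => i; rewrite !mxE /=.
pose g u := v2r (phi (t + s - u) (theta u b) (f b u)) ord0 i.
have lg : locally_integrable g by exact: locally_integrable_forcing.
rewrite linear_coord// !vintegral_coord; last 2 first.
  by move=> j; exact: locally_integrable_forcing.
  by move=> j; exact: locally_integrable_forcing.
have lgs := locally_integrable_shift s lg.
(* The last term of the identity is to be the part from [s] to [t + s] of the integral on the
   left. *)
suff -> : oriented_integral (fun u => v2r (phi (t - u) (theta u (theta s b))
    (f (theta s b) u)) ord0 i) t = oriented_integral g (t + s) - oriented_integral g s.
  rewrite [X in _ = X + _](_ : _ = oriented_integral g s); last first.
    have E j : v2r (forcing s b) ord0 j = oriented_integral
        (fun u => v2r (phi (s - u) (theta u b) (f b u)) ord0 j) s.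
      by apply: vintegral_coord => k; exact: locally_integrable_forcing.
    under eq_bigr do rewrite E.
    (* The linear map [phi t (theta s b)] passes under the integral coordinatewise; with
       [t + s - u = t + (s - u)] the cocycle property of [phi] then turns the integrand into [g]. *)
    rewrite -oriented_integral_sumZ; last first.
      by move=> j; exact: locally_integrable_forcing.
    congr oriented_integral; apply/funext => u.
    rewrite -linear_coord// /g -[t + s - u]addrA (skew_phiD flow_phi t).
    by rewrite -(skew_thetaD flow_phi) subrK.
  by rewrite [RHS]addrC subrK.
(* After the shift by [s], invariance of [f] equates the integrands for almost every [u]. *)
rewrite -oriented_integral_shift//; apply: eq_ae_oriented_integral => //.
  exact: locally_integrable_forcing.
apply: (@filterS _ (almost_everywhere mu)) fs => u fu.
by rewrite /g fu -(skew_thetaD flow_phi) (_ : t + s - (u + s) = t - u)//; ring.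
Qed.

End Forcing.

(** * The topology of the product Hilbert norm *)

Section HextTopology.
Context {R : realType} {H : finHilbertType R}.
Implicit Types z : hext H.

Lemma hext_norm_sqr z : `|z| ^+ 2 = `|z.1| ^+ 2 + z.2 ^+ 2.
Proof. by rewrite hext_normE sqr_sqrtr// addr_ge0// sqr_ge0. Qed.

Lemma hext_norm_fst z : `|z.1| <= `|z|.
Proof.
rewrite -(@ler_pXn2r _ 2) ?nnegrE// hext_norm_sqr.
by rewrite lerDl sqr_ge0.
Qed.

Lemma hext_norm_snd z : `|z.2| <= `|z|.
Proof.
rewrite -(@ler_pXn2r _ 2) ?nnegrE// hext_norm_sqr real_normK ?num_real//.
by rewrite lerDr sqr_ge0.
Qed.

(** Together with the two preceding bounds this sandwiches the Hilbert norm between the component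
    norms and their sum, so the topology is that of the product. *)
Lemma hext_norm_le z : `|z| <= `|z.1| + `|z.2|.
Proof.
rewrite -(@ler_pXn2r _ 2) ?nnegrE ?addr_ge0// hext_norm_sqr.
rewrite -[z.2 ^+ 2]real_normK ?num_real// sqrrD.
by rewrite lerD2r lerDl mulrn_wge0// mulr_ge0.
Qed.

Lemma hext_norm0 (x : H) : `|(x, 0) : hext H| = `|x|.
Proof. by rewrite hext_normE /= expr0n addr0 sqrtr_sqr ger0_norm. Qed.

Lemma hext_fst_continuous : continuous (fun z => z.1).
Proof.
move=> z; apply/(@cvgrPdist_lt _ _ _ (nbhs z)) => e e0; apply/nbhs_ballP.
exists e => // y; rewrite -ball_normE /=.
exact: le_lt_trans (hext_norm_fst (z - y)).
Qed.

Lemma hext_snd_continuous : continuous (fun z => z.2 : R).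
Proof.
move=> z; apply/(@cvgrPdist_lt _ _ _ (nbhs z)) => e e0; apply/nbhs_ballP.
exists e => // y; rewrite -ball_normE /=.
exact: le_lt_trans (hext_norm_snd (z - y)).
Qed.

Lemma hext_pair_continuous {T : topologicalType} (u : T -> H) (v : T -> R) :
  continuous u -> continuous v -> continuous (fun y => (u y, v y) : hext H).
Proof.
move=> cu cv x; apply/(@cvgrPdist_lt _ _ _ (nbhs x)) => e e0; near=> y.
apply: le_lt_trans (hext_norm_le _) _; rewrite [e]splitr ltrD//=.
- by near: y; apply: (@cvgr_dist_lt _ _ _ (nbhs x) _ u (u x) (cu x)); rewrite divr_gt0.
- by near: y; apply: (@cvgr_dist_lt _ _ _ (nbhs x) _ v (v x) (cv x)); rewrite divr_gt0.
Unshelve. all: by end_near. Qed.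

End HextTopology.

Section AffineFlowTheory.
Context {R : realType} {B : metricType R} {H : finHilbertType R}.
Variables (theta : R -> B -> B) (phi psi : R -> B -> H -> H) (f : B -> R -> H).
Hypothesis affine_psi : affine_flow theta phi f psi.
Local Notation forcing := (affine_forcing theta phi f).

Let flow_phi : is_flow (skew_product theta phi).
Proof. by have [_ []] := affine_psi. Qed.

Let linear_phi t b : linear (phi t b).
Proof. by have [_ [_ +]] := affine_psi; exact. Qed.

Let psiE t b x : psi t b x = phi t b x + forcing t b.
Proof. by have [_ _ _ _] := affine_psi; exact. Qed.

(** The forcing is [psi] at the zero vector, where the linear part vanishes; its continuity comes
    from that of the affine flow, not from the integral. *)
Lemma affine_forcing_continuous : continuous (fun p : R * B => forcing p.1 p.2).
Proof.
have [cpsi _ _ _ _] := affine_psi.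
rewrite (_ : (fun _ => _) =
    fun p : R * B => (skew_product theta psi p.1 (p.2, 0)).2); last first.
  by apply/funext => -[t b] /=; rewrite psiE linear_fun0// add0r.
apply: (continuousT_comp _ continuous_snd
  (f := fun p : R * B => skew_product theta psi p.1 (p.2, 0))).
apply: (continuousT_comp _ cpsi (f := fun p : R * B => (p.1, (p.2, 0 : H)))).
apply: continuous_pair; first exact: continuous_fst.
by apply: continuous_pair; [exact: continuous_snd|exact: continuous_cst].
Qed.

Lemma affine_forcingD t s b :
  forcing (t + s) b = phi t (theta s b) (forcing s b) + forcing t (theta s b).
Proof.
have cth : continuous (theta^~ b).
  apply: (continuousT_comp _ (skew_theta_continuous flow_phi) (f := fun s => (s, b))).
  by apply: continuous_pair; [exact: continuous_id|exact: continuous_cst].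
have cfb (g : R -> R) : continuous g -> continuous (fun s => forcing (g s) b).
  move=> cg; apply: (continuousT_comp _ affine_forcing_continuous (f := fun s => (g s, b))).
  by apply: continuous_pair => //; exact: continuous_cst.
suff : (fun s => forcing (t + s) b) =
    (fun s => phi t (theta s b) (forcing s b) + forcing t (theta s b)).
  by move=> /(congr1 (@^~ s)).
apply: ae_eq_continuous.
- by apply: cfb => x; apply: cvgD; [exact: cvg_cst|exact: cvg_id].
- have c1 : continuous (fun s => phi t (theta s b) (forcing s b)).
    apply: (continuousT_comp _ (skew_phi_continuous flow_phi)
      (f := fun s => (t, (theta s b, forcing s b)))).
    apply: continuous_pair; first exact: continuous_cst.
    by apply: continuous_pair => //; apply: cfb; exact: continuous_id.
  have c2 : continuous (fun s => forcing t (theta s b)).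
    apply: (continuousT_comp _ affine_forcing_continuous (f := fun s => (t, theta s b))).
    by apply: continuous_pair => //; exact: continuous_cst.
  by move=> x; exact: cvgD (c1 x) (c2 x).
- have := ae_affine_forcingD affine_psi b.
  by apply: (@filterS _ (almost_everywhere _)) => s'; exact.
Qed.

(** At times 0 and 0 the cocycle identity reads F = F + F. *)
Lemma affine_forcing0 b : forcing 0 b = 0.
Proof.
have := affine_forcingD 0 0 b.
rewrite addr0 (skew_phi0 flow_phi) (skew_theta0 flow_phi) => /eqP.
by rewrite -subr_eq subrr eq_sym => /eqP.
Qed.

Lemma affine_flow_is_flow : is_flow (skew_product theta psi).
Proof.
have [cpsi _ _ _ _] := affine_psi; split=> //.
  move=> [b x]; rewrite /skew_product /= psiE affine_forcing0 addr0.
  by rewrite (skew_phi0 flow_phi) (skew_theta0 flow_phi).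
move=> t s [b x]; rewrite /skew_product /= (skew_thetaD flow_phi); congr pair.
rewrite !psiE linear_funD// (skew_phiD flow_phi) affine_forcingD.
by rewrite addrA.
Qed.

(** The coordinate [r] is constant in time and enters linearly as a factor of the forcing, so the
    flow law of the lift is that of [phi] plus [r] times the cocycle identity. *)
Lemma affine_lift_linear_flow : linear_flow theta (affine_lift theta phi f).
Proof.
split; last first.
  move=> t b a [x r] [y s]; set F := forcing t b.
  rewrite [RHS](_ : _ = ((a *: (phi t b x + r *: F) + (phi t b y + s *: F),
    a * r + s) : hext H))//.
  have E : (a *: phi t b x + phi t b y) + (a * r + s) *: F =
      a *: (phi t b x + r *: F) + (phi t b y + s *: F).
    by rewrite scalerDr scalerA scalerDl addrACA.
  by congr pair; rewrite /= linear_phi; exact: E.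
split.
- apply: continuous_pair.
    apply: (continuousT_comp _ (skew_theta_continuous flow_phi)
      (f := fun p : R * (B * hext H) => (p.1, p.2.1))).
    apply: continuous_pair; first exact: continuous_fst.
    exact: continuousT_comp continuous_snd continuous_fst.
  have c21 : continuous (fun p : R * (B * hext H) => p.2.1).
    exact: continuousT_comp continuous_snd continuous_fst.
  have c22 : continuous (fun p : R * (B * hext H) => p.2.2).
    exact: continuousT_comp continuous_snd continuous_snd.
  have c222 : continuous (fun p : R * (B * hext H) => p.2.2.2 : R).
    exact: continuousT_comp c22 hext_snd_continuous.
  apply: hext_pair_continuous => //.
  have c1 : continuous (fun p : R * (B * hext H) => phi p.1 p.2.1 p.2.2.1).
    apply: (continuousT_comp _ (skew_phi_continuous flow_phi)
      (f := fun p : R * (B * hext H) => (p.1, (p.2.1, p.2.2.1)))).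
    apply: continuous_pair; first exact: continuous_fst.
    by apply: continuous_pair => //; exact: continuousT_comp c22 hext_fst_continuous.
  have c2 : continuous (fun p : R * (B * hext H) => forcing p.1 p.2.1).
    apply: (continuousT_comp _ affine_forcing_continuous
      (f := fun p : R * (B * hext H) => (p.1, p.2.1))).
    by apply: continuous_pair => //; exact: continuous_fst.
  by move=> p; exact: cvgD (c1 p) (cvgZ (c222 p) (c2 p)).
- move=> [b [x r]]; rewrite /skew_product /affine_lift /= affine_forcing0 scaler0 addr0.
  by rewrite (skew_phi0 flow_phi) (skew_theta0 flow_phi).
- move=> t s [b [x r]]; rewrite /skew_product /affine_lift /= (skew_thetaD flow_phi).
  congr (_, (_, _)).
  rewrite (linear_funD (linear_phi _ _)) (linear_funZ (linear_phi _ _)).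
  by rewrite (skew_phiD flow_phi) affine_forcingD scalerDr addrA.
Qed.

End AffineFlowTheory.

(** * Projective flows *)

Section ProjectiveMetric.
Context {R : realType} {H : normedModType R}.
Implicit Types (p q : projective H) (v w x y : H).

Lemma proj_ballE p (e : R) q : ball p e q = (proj_dist p q < e) :> Prop.
Proof. by rewrite ballEmdist. Qed.

Lemma norm_unit v : v != 0 -> `| `|v|^-1 *: v| = 1.
Proof.
by move=> v0; rewrite normrZ normfV normr_id mulVf// normr_eq0.
Qed.

(** The difference equals [(x - y) / |y| + (1/|x| - 1/|y|) x], and each summand has norm at most
    [|x - y| / |y|], the second by the reverse triangle inequality. *)
Lemma unit_dist_le x y : x != 0 -> y != 0 ->
  `|(`|x|^-1 *: x) - (`|y|^-1 *: y)| <= 2 * `|x - y| / `|y|.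
Proof.
move=> x0 y0.
have nx : 0 < `|x| by rewrite normr_gt0.
have ny : 0 < `|y| by rewrite normr_gt0.
have -> : (`|x|^-1 *: x) - (`|y|^-1 *: y) =
    `|y|^-1 *: (x - y) + (`|x|^-1 - `|y|^-1) *: x.
  by rewrite scalerBr scalerBl [RHS]addrC addrA subrK.
rewrite (le_trans (ler_normD _ _))// !normrZ normfV normr_id.
have -> : `|(`|x|^-1 - `|y|^-1)| * `|x| = `| `|y| - `|x| | / `|y|.
  rewrite -[X in _ * X = _]normr_id -normrM mulrBl mulVf ?gt_eqF//.
  rewrite -[X in `|X - _|](@mulVf _ `|y|) ?gt_eqF// -mulrBr normrM normfV normr_id.
  exact: mulrC.
rewrite mulrC -mulrDl ler_pM2r ?invr_gt0//.
by rewrite mulr_natl mulr2n lerD2l [leRHS]distrC ler_dist_dist.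
Qed.

Lemma proj_pt_dist_le x y (x0 : x != 0) (y0 : y != 0) :
  proj_dist (proj_pt x0) (proj_pt y0) <= 2 * `|x - y| / `|y|.
Proof. by rewrite proj_distE ge_min unit_dist_le. Qed.

(** The minimum in the metric is attained at one of the two opposite unit representatives of [p];
    this choice of sign turns closeness in projective space into closeness in H. *)
Lemma proj_unit_lift v (v0 : v != 0) p : `|v| = 1 ->
  exists w (w0 : w != 0), [/\ `|w| = 1, p = proj_pt w0 &
    `|v - w| = proj_dist (proj_pt v0) p].
Proof.
move=> v1; set r := proj_rep p; have r0 : r != 0 := proj_rep_neq0 p.
set u := `|r|^-1 *: r.
have u1 : `|u| = 1 by exact: norm_unit.
have u0 : u != 0 by rewrite -normr_eq0 u1 oner_eq0.
have u0' : - u != 0 by rewrite oppr_eq0.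
have pu : p = proj_pt u0.
  rewrite -[LHS]proj_ptK; apply/proj_ptP; exists `|r|^-1 => //.
  by rewrite invr_eq0 normr_eq0.
have pu' : p = proj_pt u0'.
  rewrite pu; apply/proj_ptP; exists (-1); first by rewrite oppr_eq0 oner_eq0.
  by rewrite scaleN1r.
have : proj_dist (proj_pt v0) p = Num.min `|v - u| `|v + u|.
  by rewrite pu proj_distE v1 u1 invr1 !scale1r.
rewrite /Num.min; case: ifP => _ ->; first by exists u, u0.
by exists (- u), u0'; rewrite normrN opprK.
Qed.

Lemma proj_unit_pt p : exists v (v0 : v != 0), `|v| = 1 /\ p = proj_pt v0.
Proof.
set r := proj_rep p; have r0 : r != 0 := proj_rep_neq0 p.
have u1 := norm_unit r0.
have u0 : `|r|^-1 *: r != 0 by rewrite -normr_eq0 u1 oner_eq0.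
exists (`|r|^-1 *: r), u0; split=> //.
rewrite -[LHS]proj_ptK; apply/proj_ptP; exists `|r|^-1 => //.
by rewrite invr_eq0 normr_eq0.
Qed.

(* [proj_rep] is not continuous; locally it is replaced by the unit representative
   closest to [v]. *)
Lemma proj_descend_continuous {X T : topologicalType} (g : X * projective H -> T)
    (G : X * H -> T) (gG : forall (y : X) w (w0 : w != 0), g (y, proj_pt w0) = G (y, w))
    (x : X) v (v0 : v != 0) :
  `|v| = 1 -> {for (x, v), continuous G} -> {for (x, proj_pt v0), continuous g}.
Proof.
move=> v1 cG U; rewrite gG => /cG [[A D] /= [nA /nbhs_ballP[e /= e0 De]] AD].
exists (A, ball (proj_pt v0) e) => /=; first by split=> //; exact: nbhsx_ballx.
move=> [y q] /= [Ay]; rewrite proj_ballE => vq.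
have [w [w0 [w1 qw vw]]] := proj_unit_lift v0 q v1.
rewrite qw gG; apply: (AD (y, w)); split=> //=; apply: De.
by rewrite -ball_normE /= vw.
Qed.

(** The projection extended to the zero vector by the dummy value [p], so that it can be composed
    with maps into all of H. *)
Definition proj_default p v : projective H :=
  if insub v is Some y then proj_pt (valP (y : nonzero H)) else p.

Lemma proj_defaultE p v (v0 : v != 0) : proj_default p v = proj_pt v0.
Proof.
rewrite /proj_default; case: insubP => [y _ ey|]; last by rewrite v0.
by apply/proj_ptP; exists 1; rewrite ?oner_eq0// scale1r.
Qed.

Lemma proj_default_continuous p v : v != 0 ->
  {for v, continuous (proj_default p)}.
Proof.
move=> v0; have nv : 0 < `|v| by rewrite normr_gt0.
apply/cvg_ballP => e e0; near=> w.
have w0 : w != 0.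
  by near: w; exact: (cvgr_neq0 v (@cvg_id _ (nbhs v)) v0).
(* Symmetry puts the fixed norm of [v], instead of that of [w], into the denominator of the
   bound. *)
rewrite (proj_defaultE _ v0) (proj_defaultE _ w0); apply: ball_sym.
rewrite proj_ballE (le_lt_trans (proj_pt_dist_le _ _))//.
rewrite ltr_pdivrMr// mulrC -ltr_pdivlMr// distrC; near: w.
apply: (cvgr_dist_lt _ v (@cvg_id _ (nbhs v))).
by rewrite divr_gt0// mulr_gt0.
Unshelve. all: by end_near. Qed.

End ProjectiveMetric.

Section ProjectiveFlow.
Context {R : realType} {B : metricType R} {H : finHilbertType R}.
Variables (theta : R -> B -> B) (phi : R -> B -> H -> H).
Hypothesis linear_phi : linear_flow theta phi.

Let flow_phi : is_flow (skew_product theta phi). Proof. by case: linear_phi. Qed.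

(** Running the flow back by [-t] recovers [x], whereas a linear map sends 0 to 0. *)
Lemma linear_flow_neq0 t b x : x != 0 -> phi t b x != 0.
Proof.
apply: contra_neq => phix0.
rewrite -(skew_phi0 flow_phi b x) -(addNr t) (skew_phiD flow_phi) phix0.
by apply: linear_fun0; have [_] := linear_phi; exact.
Qed.

Lemma proj_flow_is_flow : is_flow (proj_flow theta phi).
Proof.
split.
- move=> [t [b p]]; have [v [v0 [v1 ->]]] := proj_unit_pt p.
  (* Regrouping makes the projective space the last factor, as descent from vectors to lines
     requires. *)
  pose swap (z : R * (B * projective H)) := ((z.1, z.2.1), z.2.2).
  pose g (z : (R * B) * projective H) := proj_flow theta phi z.1.1 (z.1.2, z.2).
  have -> : (fun z => proj_flow theta phi z.1 z.2) = g \o swap.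
    by apply/funext => -[s [c q]].
  have cswap : continuous swap.
    apply: continuous_pair; last exact: continuousT_comp continuous_snd continuous_snd.
    apply: continuous_pair; first exact: continuous_fst.
    exact: continuousT_comp continuous_snd continuous_fst.
  apply: (@continuous_comp _ _ _ swap g); first exact: cswap.
  apply: (@proj_descend_continuous _ _ _ _ g (fun z => (theta z.1.1 z.1.2,
    proj_default p (phi z.1.1 z.1.2 z.2)))) => //.
    move=> [s c] w w0 /=; have y0 := linear_flow_neq0 s c w0.
    by rewrite /g (proj_flowE w0 y0)//= (proj_defaultE _ y0).
  have c1 : continuous (fun z : (R * B) * H => theta z.1.1 z.1.2).
    apply: (continuousT_comp _ (skew_theta_continuous flow_phi)
      (f := fun z : (R * B) * H => z.1)); exact: continuous_fst.
  have c2 : continuous (fun z : (R * B) * H => phi z.1.1 z.1.2 z.2).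
    apply: (continuousT_comp _ (skew_phi_continuous flow_phi)
      (f := fun z : (R * B) * H => (z.1.1, (z.1.2, z.2)))).
    apply: continuous_pair; first exact: continuousT_comp continuous_fst continuous_fst.
    apply: continuous_pair; last exact: continuous_snd.
    exact: continuousT_comp continuous_fst continuous_snd.
  have c3 : {for ((t, b), v), continuous
      (fun z : (R * B) * H => proj_default p (phi z.1.1 z.1.2 z.2))}.
    apply: (@continuous_comp _ _ _ (fun z : (R * B) * H => phi z.1.1 z.1.2 z.2)
      (proj_default p)); first exact: c2.
    by apply: proj_default_continuous; exact: linear_flow_neq0.
  exact: (@cvg_pair _ _ _ _ (nbhs (theta t b)) (nbhs (proj_default p (phi t b v)))
    _ _ _ _ _ (c1 ((t, b), v)) c3).
- move=> [b p]; have [v [v0 [_ ->]]] := proj_unit_pt p.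
  have y0 := linear_flow_neq0 0 b v0.
  rewrite (proj_flowE v0 y0)// (skew_theta0 flow_phi); congr pair.
  by apply/proj_ptP; exists 1; rewrite ?oner_eq0// scale1r (skew_phi0 flow_phi).
- move=> t s [b p]; have [v [v0 [_ ->]]] := proj_unit_pt p.
  have y0 := linear_flow_neq0 s b v0.
  have z0 := linear_flow_neq0 t (theta s b) y0.
  have u0 := linear_flow_neq0 (t + s) b v0.
  rewrite (proj_flowE v0 y0)// (proj_flowE y0 z0)// (proj_flowE v0 u0)//.
  rewrite (skew_thetaD flow_phi); congr pair; apply/proj_ptP.
  by exists 1; rewrite ?oner_eq0// scale1r (skew_phiD flow_phi).
Qed.

End ProjectiveFlow.

(** * Conjugacies *)

Section RestrictFlow.
Context {R : realType} {X : pseudoMetricType R}.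

Lemma set_type_ballE (Y : set X) (x y : Y) (e : R) :
  ball x e y = ball (\val x) e (\val y).
Proof. by []. Qed.

Lemma continuous_set_type {T : topologicalType} (Y : set X) (g : T -> Y) :
  continuous (fun t => \val (g t)) -> continuous g.
Proof.
move=> cg t; apply/cvg_ballP => e e0.
by have /cvg_ballP := cg t; exact.
Qed.

Lemma set_val_continuous (Y : set X) : continuous (fun y : Y => \val y : X).
Proof. exact: initial_continuous. Qed.

Lemma restrict_flow_is_flow (Phi : R -> X -> X) (Y : set X)
    (invY : forall t x, Y x -> Y (Phi t x)) :
  is_flow Phi -> is_flow (restrict_flow invY).
Proof.
move=> [cPhi Phi0 PhiD]; split.
- apply: continuous_set_type.
  apply: (continuousT_comp _ cPhi (f := fun p : R * Y => (p.1, \val p.2))).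
  apply: continuous_pair; first exact: continuous_fst.
  exact: continuousT_comp continuous_snd (@set_val_continuous _).
- by move=> x; apply: val_inj; exact: Phi0.
- by move=> t s x; apply: val_inj; exact: PhiD.
Qed.

End RestrictFlow.

(** * Transport of chains, components and their order along an isometric conjugacy *)

Section IsometricConjugacy.
Context {R : realType}.

Lemma ball_scale_continuous {X1 X2 : pseudoMetricType R} (h : X1 -> X2) (k : R) :
  0 < k ->
  (forall x e y, 0 < e -> ball x e y -> ball (h x) (k * e) (h y)) ->
  continuous h.
Proof.
move=> k0 hball x; apply/cvg_ballP => e e0; apply/nbhs_ballP.
exists (e / k) => /=; first exact: divr_gt0.
by move=> y /hball; rewrite mulrCA divff ?gt_eqF// mulr1; apply; exact: divr_gt0.
Qed.

Section Transport.
Context {X1 X2 : pseudoMetricType R}.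
Variables (Phi1 : R -> X1 -> X1) (Phi2 : R -> X2 -> X2).
Variables (h : X1 -> X2) (g : X2 -> X1).
Hypotheses (hK : cancel h g) (gK : cancel g h).
Hypothesis ball_h : forall x e y, ball (h x) e (h y) <-> ball x e y.
Hypothesis h_flow : forall t x, h (Phi1 t x) = Phi2 t (h x).

Lemma transport_chain e T n tau xi :
  is_chain Phi1 e T n tau xi -> is_chain Phi2 e T n tau (h \o xi).
Proof.
by move=> [n0 tauT chain]; split=> // i /chain; rewrite /= -h_flow ball_h.
Qed.

Lemma transport_chain_transitive Y :
  chain_transitive Phi1 Y -> chain_transitive Phi2 (h @` Y).
Proof.
move=> ctY _ _ [x Yx <-] [y Yy <-] e T e0 T0.
have [n [tau [xi [chain x0 xn]]]] := ctY _ _ Yx Yy e T e0 T0.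
by exists n, tau, (h \o xi); split=> /=; [exact: transport_chain|rewrite x0|rewrite xn].
Qed.

Lemma transport_continuous : continuous h.
Proof.
apply: (ball_scale_continuous ltr01) => x e y _; rewrite mul1r ball_h.
exact.
Qed.

Lemma transport_cancel_image (Y : set X1) : g @` (h @` Y) = Y.
Proof.
apply/seteqP; split=> [_ [_ [x Yx <-] <-]|x Yx]; first by rewrite hK.
by exists (h x); [exists x|rewrite hK].
Qed.

End Transport.

Section TransportBoth.
Context {X1 X2 : pseudoMetricType R}.
Variables (Phi1 : R -> X1 -> X1) (Phi2 : R -> X2 -> X2).
Variables (h : X1 -> X2) (g : X2 -> X1).
Hypotheses (hK : cancel h g) (gK : cancel g h).
Hypothesis ball_h : forall x e y, ball (h x) e (h y) <-> ball x e y.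
Hypothesis h_flow : forall t x, h (Phi1 t x) = Phi2 t (h x).

Lemma ball_inverse x e y : ball (g x) e (g y) <-> ball x e y.
Proof. by rewrite -ball_h !gK. Qed.

Lemma flow_inverse t x : g (Phi2 t x) = Phi1 t (g x).
Proof. by rewrite -[in LHS](gK x) -h_flow hK. Qed.

(** For maximality, a chain transitive set containing the image is pulled back by [g] to one
    containing [Y], hence to [Y] itself. *)
Lemma transport_chain_component Y :
  chain_component Phi1 Y -> chain_component Phi2 (h @` Y).
Proof.
move=> [ctY maxY]; split; first exact: transport_chain_transitive.
move=> Z ctZ YZ.
have <- : g @` Z = Y.
  apply: maxY; first exact: (transport_chain_transitive ball_inverse flow_inverse).
  by move=> x Yx; exists (h x); [apply: YZ; exists x|rewrite hK].
by rewrite (transport_cancel_image gK).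
Qed.

(** Continuity of [g] pulls limit points back. The inclusion has the direction that carries the
    conditions of [chain_order] forward along [h]. *)
Lemma transport_omega_limit x :
  omega_limit Phi2 (h x) `<=` h @` omega_limit Phi1 x.
Proof.
move=> y [t [tinfty cvgy]]; exists (g y); last exact: gK.
exists t; split=> //.
rewrite (_ : (fun k => Phi1 (t k) x) = fun k => g (Phi2 (t k) (h x))); last first.
  by apply/funext => k; rewrite -h_flow hK.
by apply: cvg_comp cvgy _; exact: (transport_continuous ball_inverse).
Qed.

Lemma transport_alpha_limit x :
  alpha_limit Phi2 (h x) `<=` h @` alpha_limit Phi1 x.
Proof.
move=> y [t [tinfty cvgy]]; exists (g y); last exact: gK.
exists t; split=> //.
rewrite (_ : (fun k => Phi1 (t k) x) = fun k => g (Phi2 (t k) (h x))); last first.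
  by apply/funext => k; rewrite -h_flow hK.
by apply: cvg_comp cvgy _; exact: (transport_continuous ball_inverse).
Qed.

Lemma transport_chain_order M M' :
  chain_order Phi1 M M' -> chain_order Phi2 (h @` M) (h @` M').
Proof.
move=> [n [N [x [<- <- compN limN]]]].
exists n, (fun k => h @` N k), (h \o x); split=> //.
  by move=> k /compN; exact: transport_chain_component.
move=> k /limN[al om]; split.
  by apply: subset_trans (@transport_alpha_limit _) _; exact: image_subset.
by apply: subset_trans (@transport_omega_limit _) _; exact: image_subset.
Qed.

End TransportBoth.

Section TransportIff.
Context {X1 X2 : pseudoMetricType R}.
Variables (Phi1 : R -> X1 -> X1) (Phi2 : R -> X2 -> X2).
Variables (h : X1 -> X2) (g : X2 -> X1).
Hypotheses (hK : cancel h g) (gK : cancel g h).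
Hypothesis ball_h : forall x e y, ball (h x) e (h y) <-> ball x e y.
Hypothesis h_flow : forall t x, h (Phi1 t x) = Phi2 t (h x).

Let ball_g x e y : ball (g x) e (g y) <-> ball x e y.
Proof. exact: ball_inverse gK ball_h _ _ _. Qed.

Let g_flow t x : g (Phi2 t x) = Phi1 t (g x).
Proof. exact: flow_inverse hK gK h_flow _ _. Qed.

Lemma chain_order_isometry M M' :
  chain_order Phi1 M M' <-> chain_order Phi2 (h @` M) (h @` M').
Proof.
split; first exact: transport_chain_order hK gK ball_h h_flow _ _.
move=> /(transport_chain_order gK hK ball_g g_flow).
by rewrite !(transport_cancel_image hK).
Qed.

Lemma ordered_components_isometry l (M : 'I_l -> set X1) :
  ordered_components Phi1 M -> ordered_components Phi2 (fun i => h @` M i).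
Proof.
move=> [injM compM ordM]; split.
- move=> i j /= hij; apply: injM.
  by rewrite -(transport_cancel_image hK (M i)) hij (transport_cancel_image hK).
- move=> N; split=> [cN|[i <-]]; last first.
    apply: (transport_chain_component hK gK ball_h h_flow).
    by apply/compM; exists i.
  have /compM[i Mi] := transport_chain_component gK hK ball_g g_flow cN.
  by exists i; rewrite Mi (transport_cancel_image gK).
- by move=> i j ij; apply/chain_order_isometry; exact: ordM.
Qed.

End TransportIff.
End IsometricConjugacy.

(** * Metric and topological properties of the maps [h0] and [h1] *)

Section Charts.
Context {R : realType} {B : metricType R} {H : finHilbertType R}.
Local Notation h0 := (@h0 R B H).
Local Notation h1 := (@h1 R B H).

Lemma hext_scale0 (a : R) (x : H) : a *: ((x, 0) : hext H) = (a *: x, 0).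
Proof. by congr pair; exact: mulr0. Qed.

(** The embedding of [x] as [(x, 0)] is linear and isometric, so both terms of the minimum are
    preserved. *)
Lemma proj_dist_hext0 (x y : H) (x0 : x != 0) (y0 : y != 0) :
  proj_dist (proj_pt (hext0_neq0 x0)) (proj_pt (hext0_neq0 y0)) =
  proj_dist (proj_pt x0) (proj_pt y0).
Proof.
rewrite !proj_distE !hext_norm0 !hext_scale0; congr Num.min.
  by rewrite -[RHS]hext_norm0; congr Num.norm; congr pair; exact: subrr.
by rewrite -[RHS]hext_norm0; congr Num.norm; congr pair; exact: addr0.
Qed.

Lemma h0_ball z e z' : ball (h0 z) e (h0 z') <-> ball z e z'.
Proof.
rewrite set_type_ballE; case: z z' => [b p] [b' p'].
have [x [x0 [_ ->]]] := proj_unit_pt p; have [y [y0 [_ ->]]] := proj_unit_pt p'.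
rewrite !h0E; split=> -[/= bb']; rewrite !proj_ballE ?proj_dist_hext0 => xy;
  by split; rewrite //= proj_ballE ?proj_dist_hext0.
Qed.

Lemma h0_inj : injective h0.
Proof.
move=> [b p] [b' p'].
have [x [x0 [_ ->]]] := proj_unit_pt p; have [y [y0 [_ ->]]] := proj_unit_pt p'.
move=> /(congr1 val); rewrite !h0E => -[-> /proj_ptP[c c0 yE]].
congr pair; apply/proj_ptP; exists c => //.
by move: yE; rewrite hext_scale0 => -[].
Qed.

Lemma h0_surj (y : Bproj10) : exists z, h0 z = y.
Proof.
have [b [p [yE [x [x0 pE]]]]] : exists b p, \val y = (b, p) /\ proj10 p.
  case: y => [[b p] /= yP]; exists b, p; split => //.
  by have [_] := set_mem yP.
by exists (b, proj_pt x0); apply: val_inj; rewrite h0E yE pE.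
Qed.

(** Preimages are chosen pointwise; continuity of the resulting inverse follows later from
    [h0_ball]. *)
Lemma h0_inverse : exists g, cancel h0 g /\ cancel g h0.
Proof.
have gP (y : Bproj10) := cid (h0_surj y).
exists (fun y => projT1 (gP y)); split=> [z|y]; last exact: projT2 (gP y).
by apply: h0_inj; exact: projT2 (gP _).
Qed.

(** The quotient [x / r] is homogeneous of degree 0, hence independent of the representative; for
    [r = 0] both sides vanish by the convention [0^-1 = 0]. *)
Lemma hext_div_proj_rep (w : hext H) (w0 : w != 0) :
  (proj_rep (proj_pt w0)).2^-1 *: (proj_rep (proj_pt w0)).1 = w.2^-1 *: w.1 :> H.
Proof.
have [c c0 ->] : exists2 c : R, c != 0 & proj_rep (proj_pt w0) = c *: w.
  by apply/(proj_ptP w0 (proj_rep_neq0 _)); rewrite proj_ptK.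
by rewrite /= invfM scalerA mulrAC mulVf// mul1r.
Qed.

Lemma h1_ball2 z e z' : 0 < e -> ball z e z' -> ball (h1 z) (2 * e) (h1 z').
Proof.
case: z z' => [b x] [b' x'] e0 [/= bb' xx']; rewrite set_type_ballE.
split=> /=; first by apply: le_ball bb'; rewrite ler_pMl// ler1n.
rewrite proj_ballE (le_lt_trans (proj_pt_dist_le _ _))//.
have n1 : 1 <= `|(x', 1) : hext H|.
  by rewrite -[leLHS](@normr1 R); exact: (hext_norm_snd ((x', 1) : hext H)).
rewrite ltr_pdivrMr; last exact: lt_le_trans n1.
rewrite -mulrA ltr_pM2l//.
rewrite (_ : _ - _ = ((x - x', 0) : hext H)); last by congr pair; exact: subrr.
rewrite hext_norm0; apply: (@lt_le_trans _ _ e).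
  by move: xx'; rewrite -ball_normE.
exact: ler_peMr (ltW e0) n1.
Qed.

Lemma h1_continuous : continuous h1.
Proof.
apply: (@ball_scale_continuous _ _ _ _ 2) => // z e z'; exact: h1_ball2.
Qed.

(** The standard affine chart of projective space, sending [P(x, r)] to [x / r]. *)
Definition h1_inv (y : @Bproj11 R B H) : B * H :=
  ((\val y).1, (proj_rep (\val y).2).2^-1 *: (proj_rep (\val y).2).1).

Lemma h1K : cancel h1 h1_inv.
Proof.
by move=> [b x]; rewrite /h1_inv /= hext_div_proj_rep /= invr1 scale1r.
Qed.

Lemma Bproj11P (y : @Bproj11 R B H) : exists b x r (r0 : r != 0),
  \val y = (b, proj_pt (hext1_neq0 x r0)).
Proof.
case: y => [[b p] /= yP]; have [_ [x [r [r0 /= ->]]]] := set_mem yP.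
by exists b, x, r, r0.
Qed.

Lemma h1_invK : cancel h1_inv h1.
Proof.
move=> y; apply: val_inj; have [b [x [r [r0 yE]]]] := Bproj11P y.
have yinv : h1_inv y = (b, r^-1 *: x) by rewrite /h1_inv yE hext_div_proj_rep.
rewrite yinv yE; congr pair; apply/proj_ptP; exists r => //=.
by congr pair; [rewrite scalerA divff ?scale1r|exact: (esym (mulr1 r))].
Qed.

Lemma h1_inv_continuous : continuous h1_inv.
Proof.
move=> y; have [b [x [r [r0 yE]]]] := Bproj11P y.
(* [k] extends the chart to the whole projective bundle, where continuity at a point descends from a
   unit representative [v]; there the denominator [v.2] is nonzero. *)
pose k (q : B * projective (hext H)) : B * H :=
  (q.1, (proj_rep q.2).2^-1 *: (proj_rep q.2).1).
apply: (@continuous_comp _ _ _ (fun y : @Bproj11 R B H => \val y) k).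
  exact: set_val_continuous.
rewrite yE; set u := proj_pt _; have [v [v0 [v1 uE]]] := proj_unit_pt u.
have v20 : v.2 != 0.
  have /proj_ptP[c c0 vE] := uE.
  by move: (congr1 snd vE) => /= ->; rewrite mulf_neq0.
rewrite uE; apply: (@proj_descend_continuous _ _ _ _ k
  (fun q => (q.1, q.2.2^-1 *: q.2.1))) => //.
  by move=> c w w0; rewrite /k /= hext_div_proj_rep.
have c1 : {for (b, v), continuous (fun q : B * hext H => q.2.2^-1 *: q.2.1)}.
  have := continuousT_comp (@continuous_snd B (hext H)) hext_snd_continuous.
  move=> /(_ (b, v)) /= c2; apply: cvgZ; first exact: cvgV c2.
  exact: (continuousT_comp continuous_snd hext_fst_continuous).
exact: (@cvg_pair _ _ _ _ (nbhs b) (nbhs (v.2^-1 *: v.1)) _ _ _ _ _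
  (@continuous_fst _ _ (b, v)) c1).
Qed.

Lemma bounded_closure_h1 (C : set (B * H)) :
  bounded_set [set x | exists b, C (b, x)] ->
  closure (set_val @` (h1 @` C)) `&` Bproj10 = set0.
Proof.
(* [bounded_set] bounds the norms by every number above [M]; the maximum with 0 makes [K + 1]
   positive. *)
move=> [M [_ hM]]; pose K := Num.max 0 (M + 1).
have K0 : 0 <= K by rewrite le_max lexx.
have hK b x : C (b, x) -> `|x| <= K.
  move=> Cbx; apply: (hM K); last by exists b.
  by rewrite lt_max ltrDl ltr01 orbT.
apply/seteqP; split=> // -[b0 p] [clp [_ [y [y0 /= pE]]]].
have e0 : 0 < (K + 1)^-1 :> R by rewrite invr_gt0 ltr_wpDl.
have [_ [[_ [[b x] Cbx <-] <-]]] := clp _ (nbhsx_ballx (b0, p) _ e0).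
move=> [/= _]; rewrite pE proj_ballE ltNge => /negP; apply.
(* The unit vectors [u] of [(y, 0)] and [w] of [(x, 1)] have last coordinates 0 and [1/|(x, 1)|], so
   both [u - w] and [u + w] have norm at least [1/(K + 1)]. *)
rewrite proj_distE; set u := _ *: _; set w := _ *: _.
have u2 : u.2 = 0 by rewrite /u hext_scale0.
have w2 : w.2 = `|(x, 1) : hext H|^-1 by rewrite /w /= ; exact: mulr1.
have n0 : 0 < `|(x, 1) : hext H|.
  by rewrite normr_gt0; exact: (hext1_neq0 x (oner_neq0 R)).
have le_w2 : (K + 1)^-1 <= `|w.2|.
  rewrite w2 normfV normr_id lef_pV2 ?posrE ?ltr_wpDl//.
  rewrite (le_trans (hext_norm_le _))//= normr1 lerD2r.
  exact: hK Cbx.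
rewrite le_min; apply/andP; split; apply: le_trans le_w2 _.
  apply: le_trans (hext_norm_snd (u - w)).
  by rewrite (_ : (u - w).2 = u.2 - w.2)// u2 sub0r normrN.
apply: le_trans (hext_norm_snd (u + w)).
by rewrite (_ : (u + w).2 = u.2 + w.2)// u2 add0r.
Qed.

Lemma closure_h1_bounded (C : set (B * H)) : compact [set: B] ->
  closure (set_val @` (h1 @` C)) `&` Bproj10 = set0 ->
  bounded_set [set x | exists b, C (b, x)].
Proof.
move=> cB clC; apply: contrapT => unb.
have zP (n : nat) : exists z, C z /\ n.+1%:R < `|z.2|.
  apply: contrapT => nz; apply: unb; exists n.+1%:R; split=> // M nM x [b Cbx].
  rewrite /= leNgt; apply/negP => xM; apply: nz; exists (b, x); split=> //=.
  exact: lt_trans xM.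
have [z zC] := choice zP.
have zn0 n : 0 < `|(z n).2| by apply: lt_trans (zC n).2.
(* The directions of an unbounded sequence in [C]; a cluster point [(b, v)] of them yields the point
   [(b, P(v, 0))] of the closure. *)
pose w n := ((z n).1, `|(z n).2|^-1 *: (z n).2).
have cK : compact ([set: B] `*` [set x : H | `|x| = 1]).
  by apply: compact_setX => //; exact: compact_sphere.
have [[b v] [[_ /= v1] clv]] : ([set: B] `*` [set x : H | `|x| = 1]) `&`
    cluster (w n @[n --> \oo]) !=set0.
  apply: cK; exists 0%N => // n _; split => //=.
  by apply: norm_unit; rewrite -normr_gt0.
have v0 : v != 0 by rewrite -normr_eq0 v1 oner_eq0.
suff : (closure (set_val @` (h1 @` C)) `&` Bproj10) (b, proj_pt (hext0_neq0 v0)).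
  by rewrite clC.
split; last by split=> //; exists v, v0.
move=> U /nbhs_ballP[e /= e0 eU].
(* The final bound is [2 * (|a x - v| + a)], so both summands must stay below a quarter of [e]. *)
have e40 : 0 < e / 4 by rewrite divr_gt0.
(* A number is less than its truncation plus one, so for [n] at least [N] the norm, which exceeds
   [n.+1], also exceeds [4 / e]. *)
pose N := (Num.truncn (e / 4)^-1).
have [_ [[n Nn <-] [/= bw vw]]] : [set w n | n in [set n | (N <= n)%N]] `&`
    ball (b, v) (e / 4) !=set0.
  apply: clv; last exact: nbhsx_ballx.
  by exists N => // n /= Nn; exists n.
exists (\val (h1 (z n))); split.
  by exists (h1 (z n)) => //; exists (z n) => //; exact: (zC n).1.
apply: eU; split=> /=.
  by apply: le_ball bw; lra.
set a := `|(z n).2|^-1 in vw.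
have a0 : 0 < a by rewrite invr_gt0.
have ae : a < e / 4.
  rewrite -[ltRHS]invrK ltf_pV2 ?posrE ?invr_gt0//.
  apply: lt_trans (zC n).2; apply: lt_le_trans (truncnS_gt _) _.
  by rewrite ler_nat ltnS.
have y0 : ((a *: (z n).2, a) : hext H) != 0 by apply: hext1_neq0; rewrite gt_eqF.
have -> : proj_pt (hext1_neq0 (z n).2 (oner_neq0 R)) = proj_pt y0.
  apply/proj_ptP; exists a; first by rewrite gt_eqF.
  by congr pair; exact: (esym (mulr1 a)).
(* By symmetry the denominator of the bound is the norm of [(v, 0)], which is 1. *)
apply: ball_sym; rewrite proj_ballE (le_lt_trans (proj_pt_dist_le _ _))//.
rewrite hext_norm0 v1 divr1.
rewrite (le_lt_trans (y := 2 * (`|a *: (z n).2 - v| + `|a|)))//.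
  rewrite ler_pM2l// (le_trans (hext_norm_le _))//= lerD2l.
  by rewrite (_ : a - 0 = a)// subr0.
rewrite (gtr0_norm a0) distrC.
by move: vw; rewrite -ball_normE /= => vw; lra.
Qed.

End Charts.

(** * Intertwining of the flows by [h0] and [h1] *)

Section Conjugacies.
Context {R : realType} {B : metricType R} {H : finHilbertType R}.
Variables (theta : R -> B -> B) (phi psi : R -> B -> H -> H) (f : B -> R -> H).
Hypothesis affine_psi : affine_flow theta phi f psi.
Local Notation h0 := (@h0 R B H).
Local Notation h1 := (@h1 R B H).

Let linear_phi : linear_flow theta phi.
Proof. by have [] := affine_psi. Qed.

Let linear_lift : linear_flow theta (affine_lift theta phi f).
Proof. exact: affine_lift_linear_flow affine_psi. Qed.

Lemma affine_lift0 t b x :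
  affine_lift theta phi f t b ((x, 0) : hext H) = (phi t b x, 0).
Proof. by rewrite /affine_lift /= scale0r addr0. Qed.

Lemma affine_lift1 t b x :
  affine_lift theta phi f t b ((x, 1) : hext H) = (psi t b x, 1).
Proof.
have [_ _ _ _ ->] := affine_psi.
by rewrite /affine_lift /= scale1r.
Qed.

Lemma h0_flow t z : h0 (proj_flow theta phi t z) = PPsi10 theta phi f t (h0 z).
Proof.
case: z => b p; have [x [x0 [_ ->]]] := proj_unit_pt p.
have y0 := linear_flow_neq0 linear_phi t b x0.
apply: val_inj; rewrite (proj_flowE x0 y0)// h0E.
rewrite [RHS](_ : _ = proj_flow theta (affine_lift theta phi f) t
  (\val (h0 (b, proj_pt x0))))// h0E.
have z0 : affine_lift theta phi f t b ((x, 0) : hext H) != 0.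
  by rewrite affine_lift0; exact: hext0_neq0.
rewrite (proj_flowE (hext0_neq0 x0) z0)//; congr pair; apply/proj_ptP.
by exists 1; rewrite ?oner_eq0// scale1r affine_lift0.
Qed.

Lemma h1_flow t z : h1 (skew_product theta psi t z) = PPsi11 theta phi f t (h1 z).
Proof.
case: z => b x; apply: val_inj.
rewrite [RHS](_ : _ = proj_flow theta (affine_lift theta phi f) t
  (b, proj_pt (hext1_neq0 x (oner_neq0 R))))//.
have z0 : affine_lift theta phi f t b ((x, 1) : hext H) != 0.
  by rewrite affine_lift1; exact: hext1_neq0 (oner_neq0 R).
rewrite (proj_flowE _ z0)//; congr pair; apply/proj_ptP.
by exists 1; rewrite ?oner_eq0// scale1r affine_lift1.
Qed.

Lemma h0_conjugacy : conjugacy (proj_flow theta phi) (PPsi10 theta phi f) h0.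
Proof.
have [g [hK gK]] := @h0_inverse R B H; split.
- exact: proj_flow_is_flow.
- by apply: restrict_flow_is_flow; exact: proj_flow_is_flow.
- split; first exact: transport_continuous (@h0_ball R B H).
  exists g; split=> //.
  exact: transport_continuous (ball_inverse gK (@h0_ball R B H)).
- exact: h0_flow.
Qed.

Lemma h1_conjugacy : conjugacy (skew_product theta psi) (PPsi11 theta phi f) h1.
Proof.
split.
- exact: affine_flow_is_flow affine_psi.
- by apply: restrict_flow_is_flow; exact: proj_flow_is_flow.
- split; first exact: h1_continuous.
  by exists h1_inv; split; [exact: h1_inv_continuous|exact: h1K|exact: h1_invK].
- exact: h1_flow.
Qed.

Lemma h1_chain (e T : R) n tau xi : 0 < e ->
  is_chain (skew_product theta psi) e T n tau xi ->
  is_chain (PPsi11 theta phi f) (2 * e) T n tau (h1 \o xi).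
Proof.
move=> e0 [n0 tauT chain]; split=> // i /chain; rewrite /= -h1_flow.
exact: h1_ball2.
Qed.

Lemma h1_chain_transitive C : chain_transitive (skew_product theta psi) C ->
  chain_transitive (PPsi11 theta phi f) (h1 @` C).
Proof.
move=> ctC _ _ [x Cx <-] [y Cy <-] e T e0 T0.
(* Chains are taken for [e / 2] to absorb the factor 2 of [h1_chain]. *)
have e20 : 0 < e / 2 by rewrite divr_gt0.
have [n [tau [xi [chain x0 xn]]]] := ctC _ _ Cx Cy _ _ e20 T0.
exists n, tau, (h1 \o xi); split=> /=; [|by rewrite x0|by rewrite xn].
by have := h1_chain e20 chain; rewrite mulrC divfK.
Qed.

End Conjugacies.

(** * Components as projections of Selgrade bundles *)

Section SelgradeBundleImage.
Context {R : realType} {B : metricType R} {H : finHilbertType R}.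
Variable M : set (B * projective H).

Lemma proj_selgrade_bundle : M = proj_set (selgrade_bundle M).
Proof.
apply/seteqP; split=> [[b p] Mp|_ [b [x [x0 [Vx ->]]]]]; last exact: Vx.
have [x [x0 [_ pE]]] := proj_unit_pt p.
exists b, x, x0; split; last by rewrite pE.
(* The bundle condition ranges over all proofs that [x] is nonzero, and these coincide. *)
by move=> x0' /=; rewrite (bool_irrelevance x0' x0) -pE.
Qed.

Lemma h0_selgrade_bundle : set_val @` (@h0 R B H @` M) =
  proj_set (prod_zero (selgrade_bundle M)).
Proof.
apply/seteqP; split=> [_ [_ [[b p] Mp <-] <-]|_ [b [z [z0 [[[b' x] Vx [bE zE]] ->]]]]].
  have [x [x0 [_ pE]]] := proj_unit_pt p.
  exists b, (x, 0), (hext0_neq0 x0); split; last by rewrite pE -h0E.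
  exists (b, x) => // x0' /=; rewrite (bool_irrelevance x0' x0) -pE.
  exact: Mp.
have x0 : x != 0 by apply: contraNneq z0 => x0; rewrite -zE x0.
rewrite -bE; exists (h0 (b', proj_pt x0)).
  by exists (b', proj_pt x0) => //; exact: Vx.
rewrite [LHS]h0E; congr pair; apply/proj_ptP.
by exists 1; rewrite ?oner_eq0// scale1r.
Qed.

End SelgradeBundleImage.

Theorem proposition9 (R : realType) (B : metricType R) (H : finHilbertType R)
    (theta : R -> B -> B) (phi psi : R -> B -> H -> H) (f : B -> R -> H)
    (compactB : compact [set: B])
    (flow_theta : is_flow theta)
    (ct_theta : chain_transitive theta [set: B])
    (affine_psi : affine_flow theta phi f psi) :
  (* (i) *)
  [/\ forall t b x,
        skew_product theta (affine_lift theta phi f) t (b, (x, 0) : hext H) =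
        (theta t b, (phi t b x, 0) : hext H),
      conjugacy (proj_flow theta phi) (PPsi10 theta phi f) h0 &
      forall (l : nat) (M : 'I_l -> set (B * projective H)),
        ordered_components (proj_flow theta phi) M ->
        [/\ forall i, M i = proj_set (selgrade_bundle (M i)),
            forall i, set_val @` (h0 @` M i) =
              proj_set (prod_zero (selgrade_bundle (M i))),
            ordered_components (PPsi10 theta phi f) (fun i => h0 @` M i) &
            forall i j,
              chain_order (proj_flow theta phi) (M i) (M j) <->
              chain_order (PPsi10 theta phi f) (h0 @` M i) (h0 @` M j)]]
  (* (ii) *)
  /\ conjugacy (skew_product theta psi) (PPsi11 theta phi f) h1
  (* (iii) *)
  /\ ((forall (e T : R) (n : nat) (tau : nat -> R) (xi : nat -> B * H),
         0 < e -> 0 < T ->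
         is_chain (skew_product theta psi) e T n tau xi ->
         is_chain (PPsi11 theta phi f) (2 * e) T n tau (h1 \o xi)) /\
      (forall C : set (B * H),
         chain_transitive (skew_product theta psi) C ->
         chain_transitive (PPsi11 theta phi f) (h1 @` C)))
  (* (iv) *)
  /\ (forall C : set (B * H),
        bounded_set [set x | exists b, C (b, x)] <->
        closure (set_val @` (h1 @` C)) `&` Bproj10 = set0).
Proof.
have [g [hK gK]] := @h0_inverse R B H.
have hball := @h0_ball R B H.
have hflow := h0_flow affine_psi.
split; [split|split; [|split; [split|]]].
- by move=> t b x; congr pair; exact: affine_lift0.
- exact: h0_conjugacy affine_psi.
- move=> l M compM; split.
  + by move=> i; exact: proj_selgrade_bundle.
  + by move=> i; exact: h0_selgrade_bundle.
  + exact: ordered_components_isometry hK gK hball hflow _ _ compM.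
  + by move=> i j; exact: chain_order_isometry hK gK hball hflow _ _.
- exact: h1_conjugacy affine_psi.
- by move=> e T n tau xi e0 _; exact: h1_chain.
- by move=> C; exact: h1_chain_transitive.
- move=> C; split; first exact: bounded_closure_h1.
  exact: closure_h1_bounded.
Qed.
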